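(* Let $\mathbb{F}$ be a field, $\Gamma,\Gamma'$ digraphs, and let $\varphi$ be an epimorphism (surjective $\mathbb{F}$-algebra homomorphism) from $L_{\mathbb{F}}(\Gamma)$ to $L_{\mathbb{F}}(\Gamma')$. (i) If $\Gamma'$ has neither a sink nor a leak then $\mathrm{Ker}\,\varphi$ is a graded ideal of $L_{\mathbb{F}}(\Gamma)$. (ii) If $\Gamma$ is row-finite, $\Gamma'$ has neither a sink nor a leak and $\varphi(v)\neq0$ for every vertex $v$ of $\Gamma$, then $\varphi$ is an isomorphism.
   Context: A digraph $\Gamma=(V,E,s,t)$ consists of arbitrary (possibly infinite) sets $V$ of vertices and $E$ of arrows and functions $s,t:E\to V$ (source, target). It is row-finite if $s^{-1}(v)$ is finite for all $v\in V$. The Leavitt path algebra $L_{\mathbb{F}}(\Gamma)$ is the (not necessarily unital) $\mathbb{F}$-algebra generated by $V\sqcup E\sqcup\{e^*: e\in E\}$ subject to: $uv=\delta_{u,v}u$ for $u,v\in V$; $s(e)e=e=e\,t(e)$ and $t(e)e^*=e^*=e^*s(e)$ for $e\in E$; (CK1) $e^*f=\delta_{e,f}t(e)$; (CK2) $v=\sum_{s(e)=v}ee^*$ for every $v$ with $0<|s^{-1}(v)|<\infty$. It is $\mathbb{Z}$-graded with $\deg v=0$, $\deg e=1$, $\deg e^*=-1$; graded ideals are with respect to this grading. A path of length $n>0$ is a sequence of arrows $e_1\cdots e_n$ with $t(e_i)=s(e_{i+1})$, with source $s(e_1)$ and target $t(e_n)$; a path of length $0$ is a vertex $v$, with $s(v)=t(v)=v$.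 A sink is a vertex $v$ with $s^{-1}(v)=\emptyset$. A leak is a vertex $v$ such that for every $n\in\mathbb{N}$ (including $0$) there is exactly one path $p_n$ of length $n$ with $s(p_n)=v$, and $t(p_m)\neq t(p_n)$ for all $m\neq n$. *)

(* Defs.v *)
From HB Require Import structures.
From mathcomp Require Import all_boot all_order all_algebra.
From mathcomp Require Import boolp classical_sets cardinality.

Set Implicit Arguments.
Unset Strict Implicit.
Unset Printing Implicit Defensive.

Import GRing.Theory.
Local Open Scope ring_scope.
Local Open Scope quotient_scope.

HB.mixin Record Lmodule_isNonUnitalAlgebra (F : fieldType) A
    of GRing.Lmodule F A := {
  nmul : A -> A -> A;
  nmulA : associative nmul;
  nmulDl : left_distributive nmul +%R;
  nmulDr : right_distributive nmul +%R;
  nscalerAl : forall (a : F) x y, a *: nmul x y = nmul (a *: x) y;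
  nscalerAr : forall (a : F) x y, a *: nmul x y = nmul x (a *: y)
}.

#[short(type="nuAlgType")]
HB.structure Definition NonUnitalAlgebra (F : fieldType) :=
  { A of Lmodule_isNonUnitalAlgebra F A & GRing.Lmodule F A }.

Notation "x *n y" := (nmul x y) (at level 40, left associativity) : ring_scope.

Definition algebra_hom (F : fieldType) (A B : nuAlgType F) (f : A -> B) :=
  linear f /\ {morph f : x y / x *n y}.

Definition algebra_epi (F : fieldType) (A B : nuAlgType F) (f : A -> B) :=
  algebra_hom f /\ (forall y, exists x, f x = y).

Definition algebra_iso (F : fieldType) (A B : nuAlgType F) (f : A -> B) :=
  algebra_hom f /\ bijective f.

Definition ker (F : fieldType) (A B : nuAlgType F) (f : A -> B) : set A :=
  [set x | f x = 0].

Definition ideal (F : fieldType) (A : nuAlgType F) (I : set A) :=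
  [/\ I 0,
      (forall (a : F) x y, I x -> I y -> I (a *: x + y))
    & (forall x y, I y -> I (x *n y) /\ I (y *n x))].

(* The algebra is the quotient of the formal expressions in the generators by
   the least congruence that contains the relations and makes the quotient an
   associative F-algebra. *)
Inductive term (F X : Type) : Type :=
| Gen of X
| Zero
| Opp of term F X
| Add of term F X & term F X
| Scale of F & term F X
| Mul of term F X & term F X.

Arguments Gen {F X}.
Arguments Zero {F X}.

Inductive congr (F : fieldType) (X : Type) (R : term F X -> term F X -> Prop) :
  term F X -> term F X -> Prop :=
| congr_rel s t : R s t -> congr R s t
| congr_refl s : congr R s s
| congr_sym s t : congr R s t -> congr R t s
| congr_trans s t u : congr R s t -> congr R t u -> congr R s u
| congr_opp s s' : congr R s s' -> congr R (Opp s) (Opp s')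
| congr_add s s' t t' :
    congr R s s' -> congr R t t' -> congr R (Add s t) (Add s' t')
| congr_scale a s s' : congr R s s' -> congr R (Scale a s) (Scale a s')
| congr_mul s s' t t' :
    congr R s s' -> congr R t t' -> congr R (Mul s t) (Mul s' t')
| congr_addA s t u : congr R (Add s (Add t u)) (Add (Add s t) u)
| congr_addC s t : congr R (Add s t) (Add t s)
| congr_add0 s : congr R (Add Zero s) s
| congr_addN s : congr R (Add (Opp s) s) Zero
| congr_scaleA a b s : congr R (Scale a (Scale b s)) (Scale (a * b) s)
| congr_scale1 s : congr R (Scale 1 s) s
| congr_scaleDr a s t :
    congr R (Scale a (Add s t)) (Add (Scale a s) (Scale a t))
| congr_scaleDl a b s :
    congr R (Scale (a + b) s) (Add (Scale a s) (Scale b s))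
| congr_mulA s t u : congr R (Mul s (Mul t u)) (Mul (Mul s t) u)
| congr_mulDl s t u : congr R (Mul (Add s t) u) (Add (Mul s u) (Mul t u))
| congr_mulDr s t u : congr R (Mul s (Add t u)) (Add (Mul s t) (Mul s u))
| congr_scaleAl a s t : congr R (Scale a (Mul s t)) (Mul (Scale a s) t)
| congr_scaleAr a s t : congr R (Scale a (Mul s t)) (Mul s (Scale a t)).

HB.instance Definition _ (F X : Type) := gen_eqMixin (term F X).
HB.instance Definition _ (F X : Type) := gen_choiceMixin (term F X).

Section Presented.
Variables (F : fieldType) (X : Type) (R : term F X -> term F X -> Prop).

Definition congrb : rel (term F X) := fun s t => `[< congr R s t >].

Lemma congrb_refl : reflexive congrb.
Proof. by move=> s; apply/asboolP; apply: congr_refl. Qed.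

Lemma congrb_sym : symmetric congrb.
Proof. by move=> s t; apply/asboolP/asboolP; apply: congr_sym. Qed.

Lemma congrb_trans : transitive congrb.
Proof.
move=> t s u /asboolP st /asboolP tu; apply/asboolP.
exact: congr_trans st tu.
Qed.

Canonical congr_equiv := EquivRel congrb congrb_refl congrb_sym congrb_trans.

Definition presented := {eq_quot congr_equiv}.
HB.instance Definition _ := Choice.on presented.
HB.instance Definition _ := EqQuotient.on presented.

Definition cls (t : term F X) : presented := \pi_presented t.

Lemma clsP s t : cls s = cls t <-> congr R s t.
Proof. by split=> [/eqmodP/asboolP|st]; last apply/eqmodP/asboolP. Qed.

Lemma congr_repr s : congr R (repr (cls s)) s.
Proof. by apply/clsP; rewrite /cls reprK. Qed.

Lemma cls_ind (P : presented -> Prop) : (forall t, P (cls t)) -> forall x, P x.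
Proof. by move=> Pt x; rewrite -[x]reprK; apply: Pt. Qed.

Definition padd (x y : presented) := cls (Add (repr x) (repr y)).
Definition popp (x : presented) := cls (Opp (repr x)).
Definition pscale (a : F) (x : presented) := cls (Scale a (repr x)).
Definition pmul (x y : presented) := cls (Mul (repr x) (repr y)).

Lemma paddE s t : padd (cls s) (cls t) = cls (Add s t).
Proof. by apply/clsP/congr_add; apply: congr_repr. Qed.

Lemma poppE s : popp (cls s) = cls (Opp s).
Proof. by apply/clsP/congr_opp; apply: congr_repr. Qed.

Lemma pscaleE a s : pscale a (cls s) = cls (Scale a s).
Proof. by apply/clsP/congr_scale; apply: congr_repr. Qed.

Lemma pmulE s t : pmul (cls s) (cls t) = cls (Mul s t).
Proof. by apply/clsP/congr_mul; apply: congr_repr. Qed.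

Lemma paddA : associative padd.
Proof.
elim/cls_ind=> s; elim/cls_ind=> t; elim/cls_ind=> u.
by rewrite !paddE; apply/clsP/congr_addA.
Qed.

Lemma paddC : commutative padd.
Proof.
elim/cls_ind=> s; elim/cls_ind=> t.
by rewrite !paddE; apply/clsP/congr_addC.
Qed.

Lemma padd0 : left_id (cls Zero) padd.
Proof. by elim/cls_ind=> s; rewrite paddE; apply/clsP/congr_add0. Qed.

Lemma paddN : left_inverse (cls Zero) popp padd.
Proof. by elim/cls_ind=> s; rewrite poppE paddE; apply/clsP/congr_addN. Qed.

HB.instance Definition _ :=
  GRing.isZmodule.Build presented paddA paddC padd0 paddN.

Lemma clsD s t : cls s + cls t = cls (Add s t).
Proof. exact: paddE. Qed.

Lemma pscaleA a b x : pscale a (pscale b x) = pscale (a * b) x.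
Proof.
by elim/cls_ind: x => s; rewrite !pscaleE; apply/clsP/congr_scaleA.
Qed.

Lemma pscale1 : left_id 1 pscale.
Proof. by elim/cls_ind=> s; rewrite pscaleE; apply/clsP/congr_scale1. Qed.

Lemma pscaleDr : right_distributive pscale +%R.
Proof.
move=> a; elim/cls_ind=> s; elim/cls_ind=> t.
by rewrite clsD !pscaleE clsD; apply/clsP/congr_scaleDr.
Qed.

Lemma pscaleDl x : {morph pscale^~ x : a b / a + b}.
Proof.
elim/cls_ind: x => s a b /=.
by rewrite !pscaleE clsD; apply/clsP/congr_scaleDl.
Qed.

HB.instance Definition _ :=
  GRing.Zmodule_isLmodule.Build F presented pscaleA pscale1 pscaleDr pscaleDl.

Lemma clsZ a s : a *: cls s = cls (Scale a s).
Proof. exact: pscaleE. Qed.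

Lemma pmulA : associative pmul.
Proof.
elim/cls_ind=> s; elim/cls_ind=> t; elim/cls_ind=> u.
by rewrite !pmulE; apply/clsP/congr_mulA.
Qed.

Lemma pmulDl : left_distributive pmul +%R.
Proof.
elim/cls_ind=> s; elim/cls_ind=> t; elim/cls_ind=> u.
by rewrite clsD !pmulE clsD; apply/clsP/congr_mulDl.
Qed.

Lemma pmulDr : right_distributive pmul +%R.
Proof.
elim/cls_ind=> s; elim/cls_ind=> t; elim/cls_ind=> u.
by rewrite clsD !pmulE clsD; apply/clsP/congr_mulDr.
Qed.

Lemma pscaleAl (a : F) x y : a *: pmul x y = pmul (a *: x) y.
Proof.
elim/cls_ind: x => s; elim/cls_ind: y => t.
by rewrite [pmul (cls s) (cls t)]pmulE !clsZ pmulE; apply/clsP/congr_scaleAl.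
Qed.

Lemma pscaleAr (a : F) x y : a *: pmul x y = pmul x (a *: y).
Proof.
elim/cls_ind: x => s; elim/cls_ind: y => t.
by rewrite [pmul (cls s) (cls t)]pmulE !clsZ pmulE; apply/clsP/congr_scaleAr.
Qed.

HB.instance Definition _ :=
  Lmodule_isNonUnitalAlgebra.Build F presented
    pmulA pmulDl pmulDr pscaleAl pscaleAr.

End Presented.

Record digraph := Digraph {
  vertex : Type;
  arrow : Type;
  source : arrow -> vertex;
  target : arrow -> vertex
}.

(* Equality on arbitrary sets of vertices and arrows is decided classically. *)
HB.instance Definition _ (G : digraph) := gen_eqMixin (vertex G).
HB.instance Definition _ (G : digraph) := gen_choiceMixin (vertex G).
HB.instance Definition _ (G : digraph) := gen_eqMixin (arrow G).
HB.instance Definition _ (G : digraph) := gen_choiceMixin (arrow G).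

Section Digraph.
Variable G : digraph.
Implicit Types (v : vertex G) (es : seq (arrow G)).

Definition out_arrows v : set (arrow G) := [set e | source e = v].

Definition row_finite := forall v, finite_set (out_arrows v).

Definition sink v := out_arrows v = set0.

(* A path with source v is given by its sequence of arrows; the empty sequence
   stands for the path v of length 0. *)
Definition path_from v es : Prop :=
  if es is e :: es' then
    source e = v /\ path [rel a b | target a == source b] e es'
  else True.

Definition path_target v es : vertex G := last v [seq target e | e <- es].

Definition leak v :=
  exists p : nat -> seq (arrow G),
    (forall n, unique (fun es => path_from v es /\ size es = n) (p n)) /\
    (forall m n, m <> n -> path_target v (p m) <> path_target v (p n)).

End Digraph.

Inductive lpa_gen (G : digraph) : Type :=
| Vertex of vertex G
| Arrow of arrow G
| Ghost of arrow G.

Definition lpa_deg (G : digraph) (x : lpa_gen G) : int :=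
  match x with
  | Vertex _ => 0
  | Arrow _ => 1
  | Ghost _ => -1
  end.

Section LeavittRelations.
Variables (F : fieldType) (G : digraph).

Local Notation V v := (@Gen F (lpa_gen G) (Vertex v)).
Local Notation A e := (@Gen F (lpa_gen G) (Arrow e)).
Local Notation A' e := (@Gen F (lpa_gen G) (Ghost e)).

Inductive lpa_rel : term F (lpa_gen G) -> term F (lpa_gen G) -> Prop :=
| lpa_vertex u v : lpa_rel (Mul (V u) (V v)) (if u == v then V u else Zero)
| lpa_source_arrow e : lpa_rel (Mul (V (source e)) (A e)) (A e)
| lpa_arrow_target e : lpa_rel (Mul (A e) (V (target e))) (A e)
| lpa_target_ghost e : lpa_rel (Mul (V (target e)) (A' e)) (A' e)
| lpa_ghost_source e : lpa_rel (Mul (A' e) (V (source e))) (A' e)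
| lpa_CK1 e f :
    lpa_rel (Mul (A' e) (A f)) (if e == f then V (target e) else Zero)
  (* es enumerates the arrows with source v, which are thus finite in number *)
| lpa_CK2 v (es : seq (arrow G)) :
    uniq es -> (forall e, e \in es <-> source e = v) -> es <> [::] ->
    lpa_rel (V v) (foldr (fun e t => Add (Mul (A e) (A' e)) t) Zero es).

End LeavittRelations.

Definition leavitt (F : fieldType) (G : digraph) := presented (@lpa_rel F G).
HB.instance Definition _ (F : fieldType) (G : digraph) :=
  NonUnitalAlgebra.on (leavitt F G).

Definition lpa_of (F : fieldType) (G : digraph) (x : lpa_gen G) : leavitt F G :=
  cls (@lpa_rel F G) (Gen x).

(* lpa_homog n is the n-th component of the grading: the linear span of the
   products of generators whose degrees add up to n. *)
Inductive lpa_homog (F : fieldType) (G : digraph) :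
  int -> leavitt F G -> Prop :=
| homog_gen x : lpa_homog (lpa_deg x) (lpa_of F x)
| homog_mul m n x y : lpa_homog m x -> lpa_homog n y ->
    lpa_homog (m + n) (x *n y)
| homog_zero n : lpa_homog n 0
| homog_add n x y : lpa_homog n x -> lpa_homog n y -> lpa_homog n (x + y)
| homog_scale n (a : F) x : lpa_homog n x -> lpa_homog n (a *: x).

(* An ideal I is graded when it is the sum of its homogeneous parts. *)
Definition graded_ideal (F : fieldType) (G : digraph) (I : set (leavitt F G)) :=
  ideal I /\
  forall x, I x -> exists (ns : seq int) (y : int -> leavitt F G),
    [/\ uniq ns, (forall n, lpa_homog n (y n) /\ I (y n))
      & x = \sum_(n <- ns) y n].

(* Main.v *)
(* An element eps <> 0 of L(G'), with G' free of sinks and leaks, has an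
   infinite-dimensional corner eps L(G') eps: some a eps b equals w + y with w
   a vertex and y a combination of paths of positive length, so x |-> eps b x a
   eps is injective on the corner at w by a lowest-degree argument, and that
   corner contains the powers of a cycle or arbitrarily many orthogonal
   projections p p^*.
   Conversely, suppose that the kernel of phi is not graded and take an element
   w + y_1 + ... + y_k of it, with w a vertex outside the kernel, with the
   fewest components.  By minimality the y_i are central modulo the kernel in
   the corner at w, so the top one is invertible there and the image of this
   corner is finite-dimensional.
   Once the kernel is graded and contains no vertex, it is zero because G has no
   sink either: a sink would have a one-dimensional corner. *)

Require Import Defs.
From mathcomp Require Import all_boot all_order all_algebra.
From mathcomp Require Import boolp classical_sets cardinality.

Set Implicit Arguments.
Unset Strict Implicit.
Unset Printing Implicit Defensive.

Import Order.TTheory GRing.Theory Num.Theory.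
Local Open Scope ring_scope.


(** Clearing ghost arrows by multiplying with arrows on the right is safe where CK2 holds, but at an
    infinite emitter or a sink [v] a nonzero element may die under every such product. What can be
    lost is measured by the projections [v - \sum e e^*] over finitely many arrows [e] out of [v].
    The reduction works as soon as [phi] kills such a projection at an irregular vertex whenever it
    kills the remaining arrows there. For the epimorphism this holds because the image of the
    projection would otherwise have a one-dimensional corner; for the identity of a sink-free graph
    the situation never occurs. So one reduction, relative to a homomorphism, serves both the kernel
    in [L(G)] and the corners of [L(G')]. A second obstacle: a presentation gives no lower bounds,
    neither that a vertex is nonzero nor that components of different degrees are independent. An
    action on functions of infinite paths, which exist when there is no sink, separates a vertex
    from longer paths; independence of the degrees is then recovered through the reduction. *)

(** * Arithmetic without a unit *)

Section NonUnitalAlgebraTheory.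
Variables (F : fieldType) (A : nuAlgType F).
Implicit Types x y z : A.

Lemma nmul0l x : 0 *n x = 0.
Proof. by rewrite -[0 in LHS](scale0r (0 : A)) -nscalerAl scale0r. Qed.

Lemma nmul0r x : x *n 0 = 0.
Proof. by rewrite -[0 in LHS](scale0r (0 : A)) -nscalerAr scale0r. Qed.

Lemma nmulNl x y : (- x) *n y = - (x *n y).
Proof. by rewrite -scaleN1r -nscalerAl scaleN1r. Qed.

Lemma nmulNr x y : x *n (- y) = - (x *n y).
Proof. by rewrite -scaleN1r -nscalerAr scaleN1r. Qed.

Lemma nmulBl x y z : (x - y) *n z = x *n z - y *n z.
Proof. by rewrite nmulDl nmulNl. Qed.

Lemma nmulBr x y z : z *n (x - y) = z *n x - z *n y.
Proof. by rewrite nmulDr nmulNr. Qed.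

Lemma nmul_suml (I : Type) (r : seq I) (P : pred I) (f : I -> A) y :
  (\sum_(i <- r | P i) f i) *n y = \sum_(i <- r | P i) f i *n y.
Proof.
exact: (big_morph (fun x => x *n y) (fun x z => nmulDl x z y) (nmul0l y)).
Qed.

Lemma nmul_sumr (I : Type) (r : seq I) (P : pred I) (f : I -> A) x :
  x *n (\sum_(i <- r | P i) f i) = \sum_(i <- r | P i) x *n f i.
Proof. exact: (big_morph (fun y => x *n y) (nmulDr x) (nmul0r x)). Qed.

End NonUnitalAlgebraTheory.

(** * Linear spans and dependence *)

Section LinearSpan.
Variables (F : fieldType) (U : lmodType F).

Inductive lspan (S : U -> Prop) : U -> Prop :=
| lspan_gen x : S x -> lspan S x
| lspan0 : lspan S 0
| lspanD x y : lspan S x -> lspan S y -> lspan S (x + y)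
| lspanZ (a : F) x : lspan S x -> lspan S (a *: x).

Lemma lspanN S x : lspan S x -> lspan S (- x).
Proof. by rewrite -scaleN1r; apply: lspanZ. Qed.

Lemma lspan_sum S (I : eqType) (r : seq I) (f : I -> U) :
  (forall i, i \in r -> lspan S (f i)) -> lspan S (\sum_(i <- r) f i).
Proof.
move=> Sf; rewrite big_seq.
by elim/big_ind: _ => //; [apply: lspan0|apply: lspanD].
Qed.

Lemma lspan_sub (S T : U -> Prop) x :
  (forall y, S y -> lspan T y) -> lspan S x -> lspan T x.
Proof.
move=> ST; elim=> {x} [x /ST //||x y _ ? _ ?|a x _ ?].
- exact: lspan0.
- exact: lspanD.
- exact: lspanZ.
Qed.

Lemma lspan_coef (bs : seq U) x : lspan (fun y => y \in bs) x ->
  exists r : 'rV[F]_(size bs), x = \sum_i r 0 i *: bs`_i.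
Proof.
elim=> {x} [x xbs||x y _ [r ->] _ [s ->]|a x _ [r ->]].
- have ib : (index x bs < size bs)%N by rewrite index_mem.
  exists (delta_mx 0 (Ordinal ib)).
  rewrite (bigD1 (Ordinal ib)) //= mxE !eqxx scale1r nth_index //.
  by rewrite big1 ?addr0 // => i /negPf ni; rewrite mxE eqxx ni scale0r.
- by exists 0; rewrite big1 // => i _; rewrite mxE scale0r.
- exists (r + s); rewrite -big_split /=.
  by apply: eq_bigr => i _; rewrite mxE scalerDl.
- exists (a *: r); rewrite scaler_sumr.
  by apply: eq_bigr => i _; rewrite mxE scalerA.
Qed.

(** The coefficient matrix has more rows than columns, so its left kernel contains a nonzero row. *)
Lemma lspan_dependent (bs : seq U) n (x : 'I_n -> U) :
  (size bs < n)%N -> (forall i, lspan (fun y => y \in bs) (x i)) ->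
  exists c : 'I_n -> F, (exists i, c i != 0) /\ \sum_i c i *: x i = 0.
Proof.
move=> lt_bn /(_ _)/lspan_coef Sx; have [r xE] := choice Sx.
pose M := \matrix_(i < n, j < size bs) r i 0 j.
have : kermx M != 0.
  rewrite -mxrank_eq0 mxrank_ker subn_eq0 -ltnNge.
  exact: leq_ltn_trans (rank_leq_col M) lt_bn.
rewrite -nz_row_eq0; set c := nz_row _ => nz_c.
have cM : c *m M = 0 by apply/sub_kermxP; exact: nz_row_sub.
exists (c 0); split.
  apply/not_existsP => c0; move/eqP: nz_c; apply; apply/rowP => i.
  by rewrite mxE; apply/eqP/negPn/negP/c0.
under eq_bigr => i _ do rewrite xE scaler_sumr.
rewrite exchange_big /= big1 // => j _.
under eq_bigr => i _ do rewrite scalerA.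
rewrite -scaler_suml; move/rowP/(_ j): cM; rewrite !mxE => cM.
under eq_bigr => i _ do have -> : r i 0 j = M i j by rewrite mxE.
by rewrite cM scale0r.
Qed.

End LinearSpan.

Lemma lspan_nmul (F : fieldType) (A : nuAlgType F) (S T U : A -> Prop) x y :
  (forall s t, S s -> T t -> lspan U (s *n t)) ->
  lspan S x -> lspan T y -> lspan U (x *n y).
Proof.
move=> STU Sx Ty; elim: Sx => {x} [x Sx||x z _ Ux _ Uz|a x _ Ux].
- elim: Ty => {y} [y Ty||y z _ Uy _ Uz|a y _ Uy].
  + exact: STU.
  + by rewrite nmul0r; apply: lspan0.
  + by rewrite nmulDr; apply: lspanD.
  + by rewrite -nscalerAr; apply: lspanZ.
- by rewrite nmul0l; apply: lspan0.
- by rewrite nmulDl; apply: lspanD.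
- by rewrite -nscalerAl; apply: lspanZ.
Qed.

(** * Relations and monomials in a Leavitt path algebra *)

Section LeavittTheory.
Variables (F : fieldType) (G : digraph).
Local Notation L := (leavitt F G).
Local Notation V v := (lpa_of F (@Vertex G v)).
Local Notation A e := (lpa_of F (@Arrow G e)).
Local Notation A' e := (lpa_of F (@Ghost G e)).
Implicit Types (u v w : vertex G) (e f : arrow G) (x y z : L).

Lemma nmul_cls s t : (cls (@lpa_rel F G) s : L) *n cls (@lpa_rel F G) t =
  cls (@lpa_rel F G) (Mul s t).
Proof. exact: pmulE. Qed.

Lemma nmulVV u v : V u *n V v = if u == v then V u else 0.
Proof.
rewrite nmul_cls; transitivity
   (cls (@lpa_rel F G) (if u == v then Gen (Vertex u) else Zero)).
  by apply/clsP/congr_rel/lpa_vertex.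
by case: eqP.
Qed.

Lemma vertex_idem v : V v *n V v = V v.
Proof. by rewrite nmulVV eqxx. Qed.

Lemma nmulVA v e : V v *n A e = if v == source e then A e else 0.
Proof.
have sA : V (source e) *n A e = A e.
  by rewrite nmul_cls; apply/clsP/congr_rel/lpa_source_arrow.
by case: eqP => [->//|/eqP/negPf vNe]; rewrite -sA nmulA nmulVV vNe nmul0l.
Qed.

Lemma nmulAV e v : A e *n V v = if v == target e then A e else 0.
Proof.
have tA : A e *n V (target e) = A e.
  by rewrite nmul_cls; apply/clsP/congr_rel/lpa_arrow_target.
rewrite eq_sym; case: eqP => [<-//|/eqP/negPf vNe].
by rewrite -tA -nmulA nmulVV vNe nmul0r.
Qed.

Lemma nmulVA' v e : V v *n A' e = if v == target e then A' e else 0.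
Proof.
have sA : V (target e) *n A' e = A' e.
  by rewrite nmul_cls; apply/clsP/congr_rel/lpa_target_ghost.
by case: eqP => [->//|/eqP/negPf vNe]; rewrite -sA nmulA nmulVV vNe nmul0l.
Qed.

Lemma nmulA'V e v : A' e *n V v = if v == source e then A' e else 0.
Proof.
have tA : A' e *n V (source e) = A' e.
  by rewrite nmul_cls; apply/clsP/congr_rel/lpa_ghost_source.
rewrite eq_sym; case: eqP => [<-//|/eqP/negPf vNe].
by rewrite -tA -nmulA nmulVV vNe nmul0r.
Qed.

Lemma nmulA'A e f : A' e *n A f = if e == f then V (target e) else 0.
Proof.
rewrite nmul_cls; transitivity
   (cls (@lpa_rel F G) (if e == f then Gen (Vertex (target e)) else Zero)).
  by apply/clsP/congr_rel/lpa_CK1.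
by case: eqP.
Qed.

Definition regular v (es : seq (arrow G)) :=
  [/\ uniq es, (forall e, e \in es <-> source e = v) & es <> [::]].

Lemma vertex_sum v es : regular v es -> V v = \sum_(e <- es) A e *n A' e.
Proof.
move=> [es_uniq esP es_neq0].
transitivity (cls (@lpa_rel F G) (foldr (fun e t =>
   Add (Mul (Gen (Arrow e)) (Gen (Ghost e))) t) Zero es)).
  by apply/clsP/congr_rel/lpa_CK2.
elim: es {es_uniq esP es_neq0} => [|e es IH]; first by rewrite big_nil.
by rewrite big_cons -IH nmul_cls /= -clsD.
Qed.

(* Span of the paths of length [n]: products of non-composable arrows vanish. *)
Inductive pspan : nat -> L -> Prop :=
| pspan_vertex v : pspan 0 (V v)
| pspan_arrow n e x : pspan n x -> pspan n.+1 (A e *n x)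
| pspan0 n : pspan n 0
| pspanD n x y : pspan n x -> pspan n y -> pspan n (x + y)
| pspanZ n (a : F) x : pspan n x -> pspan n (a *: x).

(* Span of the [p q^*] of degree [n] with [p], [q] paths and [q] of length at
   most [k]. *)
Inductive mspan : int -> nat -> L -> Prop :=
| mspan_pspan (j : nat) n k x : n = j%:Z -> pspan j x -> mspan n k x
| mspan_ghost m n k x e : n = m - 1 -> mspan m k x -> mspan n k.+1 (x *n A' e)
| mspan0 n k : mspan n k 0
| mspanD n k x y : mspan n k x -> mspan n k y -> mspan n k (x + y)
| mspanZ n k (a : F) x : mspan n k x -> mspan n k (a *: x).

Lemma vertex_nmul_pspan n v x : pspan n x -> pspan n (V v *n x).
Proof.
elim=> {n x} [u|n e x rx _|n|n x y _ rx _ ry|n a x _ rx].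
- by rewrite nmulVV; case: eqP => _; [apply: pspan_vertex|apply: pspan0].
- rewrite nmulA nmulVA; case: eqP => _; first exact: pspan_arrow.
  by rewrite nmul0l; apply: pspan0.
- by rewrite nmul0r; apply: pspan0.
- by rewrite nmulDr; apply: pspanD.
- by rewrite -nscalerAr; apply: pspanZ.
Qed.

Lemma pspan_nmul_vertex n v x : pspan n x -> pspan n (x *n V v).
Proof.
elim=> {n x} [u|n e x _ rx|n|n x y _ rx _ ry|n a x _ rx].
- by rewrite nmulVV; case: eqP => _; [apply: pspan_vertex|apply: pspan0].
- by rewrite -nmulA; apply: pspan_arrow.
- by rewrite nmul0l; apply: pspan0.
- by rewrite nmulDl; apply: pspanD.
- by rewrite -nscalerAl; apply: pspanZ.
Qed.

Lemma pspan_nmul m n x y : pspan m x -> pspan n y -> pspan (m + n) (x *n y).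
Proof.
move=> + ry; elim=> {m x} [u|m e x _ rx|m|m x z _ rx _ rz|m a x _ rx].
- exact: vertex_nmul_pspan.
- by rewrite -nmulA addSn; apply: pspan_arrow.
- by rewrite nmul0l; apply: pspan0.
- by rewrite nmulDl; apply: pspanD.
- by rewrite -nscalerAl; apply: pspanZ.
Qed.

Lemma pspanA e : pspan 1 (A e).
Proof.
by have := pspan_arrow e (pspan_vertex (target e)); rewrite nmulAV eqxx.
Qed.

Lemma ghost_nmul_pspan n e x : pspan n.+1 x -> pspan n (A' e *n x).
Proof.
suff pspan_eq m : pspan m x -> m = n.+1 -> pspan n (A' e *n x).
  by move/pspan_eq; apply.
elim=> {m x} [//|m f x rx _ [<-]|m _|m x y _ rx _ ry mE|m a x _ rx mE].
- rewrite nmulA nmulA'A; case: eqP => _; first exact: vertex_nmul_pspan.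
  by rewrite nmul0l; apply: pspan0.
- by rewrite nmul0r; apply: pspan0.
- by rewrite nmulDr; apply: pspanD; [apply: rx|apply: ry].
- by rewrite -nscalerAr; apply: pspanZ; apply: rx.
Qed.

Lemma vertex_nmul_pspan0 v x : pspan 0 x -> exists a, V v *n x = a *: V v.
Proof.
suff pspan_eq m : pspan m x -> m = 0%N -> exists a, V v *n x = a *: V v.
  by move/pspan_eq; apply.
elim=> {m x} [u _|//|m _|m x y _ IHx _ IHy mE|m b x _ IH mE].
- exists (v == u)%:R; rewrite nmulVV.
  by case: (v == u); rewrite (scale1r, scale0r).
- by exists 0; rewrite nmul0r scale0r.
- have [[a aE] [b bE]] := (IHx mE, IHy mE).
  by exists (a + b); rewrite nmulDr aE bE scalerDl.
- by have [a aE] := IH mE; exists (b * a); rewrite -nscalerAr aE scalerA.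
Qed.

Lemma lpa_homog_cast (m n : int) x : m = n -> lpa_homog m x -> lpa_homog n x.
Proof. by move=> ->. Qed.

Lemma homogV v : lpa_homog 0 (V v).
Proof. exact: (homog_gen F (Vertex v)). Qed.

Lemma homogA e : lpa_homog 1 (A e).
Proof. exact: (homog_gen F (Arrow e)). Qed.

Lemma homogA' e : lpa_homog (-1) (A' e).
Proof. exact: (homog_gen F (Ghost e)). Qed.

Lemma homogN n x : lpa_homog n x -> lpa_homog n (- x).
Proof. by rewrite -scaleN1r; apply: homog_scale. Qed.

Lemma homog_vertex_nmul n v x : lpa_homog n x -> lpa_homog n (V v *n x).
Proof. by move/(homog_mul (homogV v)); rewrite add0r. Qed.

Lemma homog_nmul_vertex n v x : lpa_homog n x -> lpa_homog n (x *n V v).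
Proof. by move/homog_mul => /(_ _ _ (homogV v)); rewrite addr0. Qed.

Lemma pspan_homog n x : pspan n x -> lpa_homog n%:Z x.
Proof.
elim=> {n x} [v|n e x _ hx|n|n x y _ hx _ hy|n a x _ hx].
- exact: homogV.
- by rewrite intS; apply: homog_mul => //; apply: homogA.
- exact: homog_zero.
- exact: homog_add.
- exact: homog_scale.
Qed.

Lemma mspan_leq n k k' x : (k <= k')%N -> mspan n k x -> mspan n k' x.
Proof.
move=> lek mx; elim: mx k' lek => {n k x}
  [j n k x nE rx k' _|m n k x e nE _ mx [//|k'] lek|n k k' _
  |n k x y _ mx _ my k' lek|n k a x _ mx k' lek].
- exact: mspan_pspan nE rx.
- by apply: mspan_ghost nE _; apply: mx.
- exact: mspan0.
- by apply: mspanD; [apply: mx|apply: my].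
- by apply: mspanZ; apply: mx.
Qed.

Lemma mspan_nmul_vertex n k v x : mspan n k x -> mspan n k (x *n V v).
Proof.
elim=> {n k x}
  [j n k x nE rx|m n k x e nE mx _|n k|n k x y _ mx _ my|n k a x _ mx].
- exact: mspan_pspan nE (pspan_nmul_vertex _ rx).
- rewrite -nmulA nmulA'V; case: eqP => _; first exact: mspan_ghost nE _.
  by rewrite nmul0r; apply: mspan0.
- by rewrite nmul0l; apply: mspan0.
- by rewrite nmulDl; apply: mspanD.
- by rewrite -nscalerAl; apply: mspanZ.
Qed.

(** By CK1 an arrow on the right either cancels the last ghost arrow or kills the monomial. Hence
    [k] successive arrows leave a combination of paths. *)
Lemma mspan_nmul_arrow n k e x : mspan n k x -> mspan (n + 1) k.-1 (x *n A e).
Proof.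
elim=> {n k x}
  [j n k x -> rx|m n k x f -> mx _|n k|n k x y _ mx _ my|n k a x _ mx].
- apply: mspan_pspan (pspan_nmul rx (pspanA e)).
  by rewrite PoszD.
- rewrite -nmulA nmulA'A subrK; case: eqP => _; first exact: mspan_nmul_vertex.
  by rewrite nmul0r; apply: mspan0.
- by rewrite nmul0l; apply: mspan0.
- by rewrite nmulDl; apply: mspanD.
- by rewrite -nscalerAl; apply: mspanZ.
Qed.

Lemma mspan0_pspan (j : nat) x : mspan j%:Z 0 x -> pspan j x.
Proof.
suff mspan_pspan_eq n k : mspan n k x -> n = j%:Z -> k = 0%N -> pspan j x.
  by move/mspan_pspan_eq; apply.
elim=> {n k x}
  [i n k x -> rx [<-]//|//|*|n k x y _ rx _ ry nE kE|n k a x _ rx nE kE].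
- exact: pspan0.
- by apply: pspanD; [apply: rx|apply: ry].
- by apply: pspanZ; apply: rx.
Qed.

Lemma mspan_nmul_pspan n k (j : nat) x y : mspan n k x -> pspan j y ->
  exists k', mspan (n + j%:Z) k' (x *n y).
Proof.
move=> + ry; elim: ry n k x => {j y}
   [v|j e y _ IH|j|j y z _ IHy _ IHz|j a y _ IH] n k x mx.
- by exists k; rewrite addr0; apply: mspan_nmul_vertex.
- rewrite nmulA intS addrA; apply: IH (mspan_nmul_arrow e mx).
- by exists 0%N; rewrite nmul0r; apply: mspan0.
- have [k1 m1] := IHy _ _ _ mx; have [k2 m2] := IHz _ _ _ mx.
  exists (maxn k1 k2); rewrite nmulDr.
  by apply: mspanD; [apply: mspan_leq m1|apply: mspan_leq m2];
     rewrite leq_max leqnn ?orbT.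
- by have [k1 m1] := IH _ _ _ mx; exists k1; rewrite -nscalerAr; apply: mspanZ.
Qed.

Lemma mspan_nmul n k m l x y : mspan n k x -> mspan m l y ->
  exists k', mspan (n + m) k' (x *n y).
Proof.
move=> mx; elim=> {m l y}
   [j m l y -> ry|i m l y e -> _ [k' IH]|m l
   |m l y z _ [k1 m1] _ [k2 m2]|m l a y _ [k' IH]].
- exact: mspan_nmul_pspan mx ry.
- exists k'.+1; rewrite nmulA; apply: mspan_ghost IH.
  by rewrite addrA.
- by exists 0%N; rewrite nmul0r; apply: mspan0.
- exists (maxn k1 k2); rewrite nmulDr.
  by apply: mspanD; [apply: mspan_leq m1|apply: mspan_leq m2];
     rewrite leq_max leqnn ?orbT.
- by exists k'; rewrite -nscalerAr; apply: mspanZ.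
Qed.

Lemma homog_mspan n x : lpa_homog n x -> exists k, mspan n k x.
Proof.
elim=> {n x}
  [[v|e|e]|m n x y _ [k mx] _ [l my]|n|n x y _ [k mx] _ [l my]|n a x _ [k mx]].
- by exists 0%N; apply: (mspan_pspan (j := 0)) => //; apply: pspan_vertex.
- by exists 0%N; apply: (mspan_pspan (j := 1)) => //; apply: pspanA.
- exists 1%N; have -> : lpa_of F (Ghost e) = V (target e) *n A' e.
    by rewrite nmulVA' eqxx.
  apply: (mspan_ghost (m := 0)); first by [].
  by apply: (mspan_pspan (j := 0)) => //; apply: pspan_vertex.
- exact: mspan_nmul mx my.
- by exists 0%N; apply: mspan0.
- exists (maxn k l); apply: mspanD; [apply: mspan_leq mx|apply: mspan_leq my];
     by rewrite leq_max leqnn ?orbT.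
- by exists k; apply: mspanZ.
Qed.

Lemma leavitt_ind (P : L -> Prop) :
  (forall g, P (lpa_of F g)) -> P 0 ->
  (forall x y, P x -> P y -> P (x + y)) ->
  (forall (a : F) x, P x -> P (a *: x)) ->
  (forall x y, P x -> P y -> P (x *n y)) -> forall x, P x.
Proof.
move=> Pg P0 PD PZ PM; apply: cls_ind.
elim=> [g||t Pt|s Ps t Pt|a t Pt|s Ps t Pt].
- exact: Pg.
- exact: P0.
- have -> : cls (@lpa_rel F G) (Opp t) = - (cls (@lpa_rel F G) t : L).
    exact/esym/poppE.
  by rewrite -scaleN1r; apply: PZ.
- by rewrite -clsD; apply: PD.
- by rewrite -clsZ; apply: PZ.
- by rewrite -nmul_cls; apply: PM.
Qed.

End LeavittTheory.

(** * Homomorphisms and their kernels *)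

Lemma sum_above (U : zmodType) (ns : seq nat) (m : nat) (t : nat -> U) :
  uniq ns -> m \in ns -> {in ns, forall i, (i < m)%N -> t i = 0} ->
  \sum_(i <- ns) t i = t m + \sum_(i <- [seq i <- ns | (m < i)%N]) t i.
Proof.
move=> ns_uniq mns t0; rewrite (bigD1_seq m) //=; congr (_ + _).
rewrite big_filter (bigID (fun i => (m < i)%N)) /= [X in _ + X]big_seq_cond.
rewrite [X in _ + X]big1 ?addr0 => [|i /and3P[ins im]].
  by apply: eq_bigl => i; case: ltngtP.
by rewrite -leqNgt leq_eqVlt (negPf im) => /t0; apply.
Qed.

Section AlgebraHom.
Variables (F : fieldType) (A B : nuAlgType F) (phi : A -> B).
Hypothesis phi_hom : algebra_hom phi.

Lemma algebra_homD x y : phi (x + y) = phi x + phi y.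
Proof. by have := phi_hom.1 1 x y; rewrite !scale1r. Qed.

Lemma algebra_hom0 : phi 0 = 0.
Proof. by apply: (addIr (phi 0)); rewrite -algebra_homD !add0r. Qed.

Lemma algebra_homZ a x : phi (a *: x) = a *: phi x.
Proof. by rewrite -[a *: x]addr0 phi_hom.1 algebra_hom0 addr0. Qed.

Lemma algebra_homN x : phi (- x) = - phi x.
Proof. by rewrite -scaleN1r algebra_homZ scaleN1r. Qed.

Lemma algebra_homB x y : phi (x - y) = phi x - phi y.
Proof. by rewrite algebra_homD algebra_homN. Qed.

Lemma algebra_homM x y : phi (x *n y) = phi x *n phi y.
Proof. exact: phi_hom.2. Qed.

Lemma algebra_hom_sum (I : Type) (r : seq I) (P : pred I) (f : I -> A) :
  phi (\sum_(i <- r | P i) f i) = \sum_(i <- r | P i) phi (f i).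
Proof. exact: (big_morph _ algebra_homD algebra_hom0). Qed.

Lemma algebra_hom_lspan (bs : seq A) x :
  lspan (fun y => y \in bs) x -> lspan (fun y => y \in map phi bs) (phi x).
Proof.
elim=> {x} [x xbs||x y _ ? _ ?|a x _ ?].
- by apply/lspan_gen/map_f.
- by rewrite algebra_hom0; apply: lspan0.
- by rewrite algebra_homD; apply: lspanD.
- by rewrite algebra_homZ; apply: lspanZ.
Qed.

Lemma ker_ideal : ideal (ker phi).
Proof.
split=> [|a x y /= x0 y0|x y /= y0]; rewrite /ker /=.
- exact: algebra_hom0.
- by rewrite algebra_homD algebra_homZ x0 y0 scaler0 addr0.
- by rewrite !algebra_homM y0 nmul0l nmul0r.
Qed.

End AlgebraHom.

Lemma algebra_hom_id (F : fieldType) (A : nuAlgType F) :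
  algebra_hom (id : A -> A).
Proof. by []. Qed.

(** * Degree filtrations and local units *)

Section Grading.
Variables (F : fieldType) (G : digraph).
Local Notation L := (leavitt F G).
Local Notation V v := (lpa_of F (@Vertex G v)).
Local Notation A e := (lpa_of F (@Arrow G e)).
Local Notation A' e := (lpa_of F (@Ghost G e)).
Implicit Types (u v w : vertex G) (e f : arrow G) (x y z : L).

Definition homog_ge (d : int) : L -> Prop :=
  lspan (fun x => exists2 n, d <= n & lpa_homog n x).

Definition pspan_ge (k : nat) : L -> Prop :=
  lspan (fun x => exists2 n, (k <= n)%N & pspan n x).

Lemma homog_geW d n x : d <= n -> lpa_homog n x -> homog_ge d x.
Proof. by move=> dn hx; apply: lspan_gen; exists n. Qed.

Lemma pspan_geW k n x : (k <= n)%N -> pspan n x -> pspan_ge k x.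
Proof. by move=> kn rx; apply: lspan_gen; exists n. Qed.

Lemma homog_ge_leq d d' x : d' <= d -> homog_ge d x -> homog_ge d' x.
Proof.
move=> le_dd'; apply: lspan_sub => y [n dn hy].
by apply: homog_geW hy; apply: le_trans dn.
Qed.

Lemma homog_ge_nmul c d x y :
  homog_ge c x -> homog_ge d y -> homog_ge (c + d) (x *n y).
Proof.
apply: lspan_nmul => s t [m cm hs] [n dn ht].
by apply: homog_geW (homog_mul hs ht); apply: lerD.
Qed.

Lemma pspan_ge_nmul k l x y :
  pspan_ge k x -> pspan_ge l y -> pspan_ge (k + l) (x *n y).
Proof.
apply: lspan_nmul => s t [m km rs] [n ln rt].
by apply: pspan_geW (pspan_nmul rs rt); apply: leq_add.
Qed.

Lemma pspan_ge_homog_ge k x : pspan_ge k x -> homog_ge k%:Z x.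
Proof.
by apply: lspan_sub => y [n kn /pspan_homog]; apply: homog_geW; rewrite lez_nat.
Qed.

Lemma leavitt_homog_ge x : exists d, homog_ge d x.
Proof.
elim/leavitt_ind: x => [g||x y [c hx] [d hy]|a x [d hx]|x y [c hx] [d hy]].
- by exists (lpa_deg g); apply: homog_geW (homog_gen F g).
- by exists 0; apply: lspan0.
- exists (Order.min c d); apply: lspanD.
    by apply: homog_ge_leq hx; rewrite ge_min lexx.
  by apply: homog_ge_leq hy; rewrite ge_min lexx orbT.
- by exists d; apply: lspanZ.
- by exists (c + d); apply: homog_ge_nmul.
Qed.

Lemma sum_iota_widen (y : nat -> L) K K' : (K <= K')%N ->
  (forall i, (K <= i)%N -> y i = 0) ->
  \sum_(i <- iota 0 K) y i = \sum_(i <- iota 0 K') y i.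
Proof.
move=> le_KK' y0; rewrite -(subnKC le_KK') iotaD big_cat /= add0n.
rewrite [X in _ = _ + X]big1_seq ?addr0 // => i /=.
by rewrite mem_iota => /andP[/y0].
Qed.

Lemma homog_ge_sum (d : int) x : homog_ge d x ->
  exists (K : nat) (y : nat -> L), [/\ forall i, lpa_homog (d + i%:Z) (y i),
    forall i, (K <= i)%N -> y i = 0 & x = \sum_(i <- iota 0 K) y i].
Proof.
elim=> {x} [x [n dn hx]||x1 x2 _ [K1 [y1 [h1 z1 ->]]] _ [K2 [y2 [h2 z2 ->]]]
   |a x _ [K [y [hy zy ->]]]].
- have nE : d + (`|n - d|%N)%:Z = n.
    by rewrite gez0_abs ?subr_ge0 // addrCA subrr addr0.
  exists `|n - d|%N.+1, (fun i => if i == `|n - d|%N then x else 0); split.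
  + by move=> i; case: eqP => [->|_]; [rewrite nE|apply: homog_zero].
  + by move=> i; case: eqP => // ->; rewrite ltnn.
  + rewrite -addn1 iotaD big_cat big_seq1 add0n eqxx.
    rewrite [\sum_(i <- _) _]big1_seq /= ?add0r // => i; rewrite mem_iota add0n.
    by case: eqP => // ->; rewrite ltnn.
- exists 0%N, (fun=> 0); split=> [i|//|]; first exact: homog_zero.
  by rewrite big_nil.
- exists (maxn K1 K2), (fun i => y1 i + y2 i); split=> [i|i|].
  + exact: homog_add.
  + by rewrite geq_max => /andP[/z1-> /z2->]; rewrite addr0.
  + rewrite big_split /=.
    by congr (_ + _); apply: sum_iota_widen => //; rewrite leq_max leqnn ?orbT.
- exists K, (fun i => a *: y i); split=> [i|i /zy ->|]; last by rewrite scaler_sumr.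
    exact: homog_scale.
  by rewrite scaler0.
Qed.

Lemma leavitt_sum x : exists (d : int) (K : nat) (y : nat -> L),
  (forall i, lpa_homog (d + i%:Z) (y i)) /\ x = \sum_(i <- iota 0 K) y i.
Proof.
have [d /homog_ge_sum [K [y [hy _ xE]]]] := leavitt_homog_ge x.
by exists d, K, y.
Qed.

(* Elements on which the sum of the [t i] acts as a one-sided unit. *)
Definition left_unit (I : eqType) (t : I -> L) x := exists s0 : seq I,
  forall s, uniq s -> {subset s0 <= s} -> \sum_(i <- s) t i *n x = x.

Lemma left_unitD (I : eqType) (t : I -> L) x y :
  left_unit t x -> left_unit t y -> left_unit t (x + y).
Proof.
move=> [r rP] [s sP]; exists (r ++ s) => p p_uniq rsp.
under eq_bigr => i _ do rewrite nmulDr.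
rewrite big_split /= rP ?sP // => i ip; apply: rsp; rewrite mem_cat ip ?orbT //.
Qed.

Lemma left_unitZ (I : eqType) (t : I -> L) (a : F) x :
  left_unit t x -> left_unit t (a *: x).
Proof.
move=> [r rP]; exists r => p p_uniq rp.
under eq_bigr => i _ do rewrite -nscalerAr.
by rewrite -scaler_sumr rP.
Qed.

Lemma left_unit0 (I : eqType) (t : I -> L) : left_unit t 0.
Proof. by exists [::] => p _ _; rewrite big1 // => i _; rewrite nmul0r. Qed.

Lemma left_unit1 (I : eqType) (t : I -> L) i x : t i *n x = x ->
  (forall j, j != i -> t j *n x = 0) -> left_unit t x.
Proof.
move=> ti tj; exists [:: i] => s s_uniq /(_ i) is_; rewrite (bigD1_seq i) //=.
  by rewrite ti big1 ?addr0.
by apply: is_; rewrite mem_head.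
Qed.

Lemma left_unitM (I : eqType) (t : I -> L) x y :
  left_unit t x -> left_unit t (x *n y).
Proof.
move=> [r rP]; exists r => p p_uniq rp.
under eq_bigr => i _ do rewrite nmulA.
by rewrite -nmul_suml rP.
Qed.

(** With infinitely many vertices there is no identity; finite sums of vertices replace it. *)
Lemma vertex_left_unit x : left_unit (fun v => V v) x.
Proof.
elim/leavitt_ind: x => [[v|e|e]||x y hx hy|a x hx|x y hx hy].
- apply: (left_unit1 (i := v)) => [|u /negPf uv].
    by rewrite nmulVV eqxx.
  by rewrite nmulVV uv.
- apply: (left_unit1 (i := source e)) => [|u /negPf uv].
    by rewrite nmulVA eqxx.
  by rewrite nmulVA uv.
- apply: (left_unit1 (i := target e)) => [|u /negPf uv].
    by rewrite nmulVA' eqxx.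
  by rewrite nmulVA' uv.
- exact: left_unit0.
- exact: left_unitD.
- exact: left_unitZ.
- exact: left_unitM.
Qed.

(** On paths of positive length CK1 alone makes the [e e^*] act as a unit, so infinite emitters
    cause no trouble here. *)
Lemma pspan_left_unit n x : pspan n.+1 x -> left_unit (fun e => A e *n A' e) x.
Proof.
suff pspan_eq m : pspan m x -> m = n.+1 -> left_unit (fun e => A e *n A' e) x.
  by move/pspan_eq; apply.
elim=> {m x} [//|m e x _ _ _|m _|m x y _ hx _ hy mE|m a x _ hx mE].
- apply/left_unitM/(left_unit1 (i := e)) => [|f /negPf fe].
    by rewrite -nmulA nmulA'A eqxx nmulAV eqxx.
  by rewrite -nmulA nmulA'A fe nmul0r.
- exact: left_unit0.
- by apply: left_unitD; [apply: hx|apply: hy].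
- by apply: left_unitZ; apply: hx.
Qed.

Lemma vertex_right_unit x : exists s, x = \sum_(v <- s) x *n V v.
Proof.
suff [s0 s0P] : exists s0 : seq (vertex G),
    forall s, uniq s -> {subset s0 <= s} -> x = \sum_(v <- s) x *n V v.
  exists (undup s0); apply: s0P; first exact: undup_uniq.
  by move=> i; rewrite mem_undup.
have gen y v : y *n V v = y -> (forall u, u != v -> y *n V u = 0) ->
    exists s0 : seq (vertex G),
    forall s, uniq s -> {subset s0 <= s} -> y = \sum_(v <- s) y *n V v.
  move=> yv yu; exists [:: v] => s s_uniq /(_ v) vs; rewrite (bigD1_seq v) //=.
    by rewrite yv big1 ?addr0.
  by apply: vs; rewrite mem_head.
elim/leavitt_ind: x => [[v|e|e]||x y [r rP] [s sP]|a x [r rP]|x y _ [s sP]].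
- apply: (gen _ v) => [|u /negPf uv]; first by rewrite nmulVV eqxx.
  by rewrite nmulVV eq_sym uv.
- apply: (gen _ (target e)) => [|u /negPf uv]; first by rewrite nmulAV eqxx.
  by rewrite nmulAV uv.
- apply: (gen _ (source e)) => [|u /negPf uv]; first by rewrite nmulA'V eqxx.
  by rewrite nmulA'V uv.
- by exists [::] => s _ _; rewrite big1 // => v _; rewrite nmul0l.
- exists (r ++ s) => p p_uniq rsp.
  under eq_bigr => i _ do rewrite nmulDl.
  rewrite big_split /=; congr (_ + _); [apply: rP|apply: sP] => // i ip;
    by apply: rsp; rewrite mem_cat ip ?orbT.
- exists r => p p_uniq rp; under eq_bigr => i _ do rewrite -nscalerAl.
  by rewrite -scaler_sumr -rP.
- exists s => p p_uniq sp; under eq_bigr => i _ do rewrite -nmulA.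
  by rewrite -nmul_sumr -sP.
Qed.

Lemma left_unit_undup (I : eqType) (t : I -> L) x : left_unit t x ->
  exists s, \sum_(i <- s) t i *n x = x.
Proof.
move=> [s sP]; exists (undup s); apply: sP; first exact: undup_uniq.
by move=> i; rewrite mem_undup.
Qed.

End Grading.

(** * Reduction of an element to a vertex modulo a kernel *)

Section Reduction.
Variables (F : fieldType) (G : digraph) (B : nuAlgType F).
Variable phi : leavitt F G -> B.
Hypothesis phi_hom : algebra_hom phi.
Local Notation L := (leavitt F G).
Local Notation V v := (lpa_of F (@Vertex G v)).
Local Notation A e := (lpa_of F (@Arrow G e)).
Local Notation A' e := (lpa_of F (@Ghost G e)).
Implicit Types (u v w : vertex G) (e f : arrow G) (x y z : L).

Let phi0 := algebra_hom0 phi_hom.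
Let phiB := algebra_homB phi_hom.
Let phiZ := algebra_homZ phi_hom.
Let phiM := algebra_homM phi_hom.
Let phi_sum := algebra_hom_sum phi_hom.

Lemma phi_sum_neq0 (I : eqType) (s : seq I) (t : I -> L) :
  phi (\sum_(i <- s) t i) != 0 -> exists2 i, i \in s & phi (t i) != 0.
Proof.
move=> nz; apply: contrapT => none; move/eqP: nz; apply.
rewrite phi_sum big1_seq // => i /= si; apply: contrapT => /eqP ti.
by apply: none; exists i.
Qed.

(** Since the [e e^*] add up to a unit on [x], some first arrow [e] can be stripped off without
    falling into the kernel. So [a] is a vertex times a ghost path of length [n]; the last clause
    lets the same [a] act on the longer components of a family. *)
Lemma pspan_reduce n x : pspan n x -> phi x != 0 ->
  exists a w (k : F), [/\ k != 0, a *n x = k *: V w, phi (V w) != 0,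
    lpa_homog (- n%:Z) a & forall m y, pspan (n + m) y -> pspan m (a *n y)].
Proof.
elim: n x => [|n IH] x rx nz.
  have [s sE] := left_unit_undup (vertex_left_unit x).
  move: nz; rewrite -{1}sE => /phi_sum_neq0 [w _].
  have [k kE] := vertex_nmul_pspan0 w rx; rewrite kE phiZ => nz.
  exists (V w), w, k; split; rewrite ?oppr0 ?kE //.
  - by apply: contra_neq nz => ->; rewrite scale0r.
  - by apply: contra_neq nz => ->; rewrite scaler0.
  - exact: homogV.
  - by move=> m y; apply: vertex_nmul_pspan.
have [s sE] := left_unit_undup (pspan_left_unit rx).
move: (nz); rewrite -{1}sE => /phi_sum_neq0 [e _].
rewrite -nmulA phiM => nze.
have nzx : phi (A' e *n x) != 0 by apply: contra_neq nze => ->; rewrite nmul0r.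
have [a [w [k [k0 aE w0 ha ra]]]] := IH _ (ghost_nmul_pspan e rx) nzx.
exists (a *n A' e), w, k; split=> //.
- by rewrite -nmulA.
- apply: lpa_homog_cast (homog_mul ha (homogA' F e)).
  by rewrite intS opprD addrC.
- by move=> m y ry; rewrite -nmulA; apply/ra/ghost_nmul_pspan.
Qed.

(** For distinct arrows out of [v] this is the projection that CK2 would annihilate if [es] were all
    of them. *)
Definition gap v (es : seq (arrow G)) : L := V v - \sum_(e <- es) A e *n A' e.

Lemma gap_nmul_arrow v es f : source f = v -> f \notin es ->
  gap v es *n A f = A f.
Proof.
move=> fv fes; rewrite nmulBl nmulVA -fv eqxx nmul_suml big1_seq ?subr0 //.
move=> e /= ees; rewrite -nmulA nmulA'A.
by case: eqP ees fes => [-> ->//|_ _ _]; rewrite nmul0r.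
Qed.

Lemma ghost_nmul_gap v es e : uniq es -> {in es, forall f, source f = v} ->
  (source e = v -> e \in es) -> A' e *n gap v es = 0.
Proof.
move=> es_uniq esv ees; rewrite nmulBr nmulA'V nmul_sumr eq_sym.
have [ev|ev] := eqVneq (source e) v.
  rewrite (bigD1_seq e) ?ees //= nmulA nmulA'A eqxx nmulVA' eqxx.
  rewrite big1 ?addr0 ?subrr // => f /negPf fe.
  by rewrite nmulA nmulA'A eq_sym fe nmul0l.
rewrite big1_seq ?subr0 // => f /= fes; rewrite nmulA nmulA'A.
have [ef|_] := eqVneq e f; last by rewrite nmul0l.
by rewrite ef esv ?eqxx in ev.
Qed.

Lemma gap_nmul_arrow0 v es e : uniq es -> {in es, forall f, source f = v} ->
  (source e = v -> e \in es) -> gap v es *n A e = 0.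
Proof.
move=> es_uniq esv ees; rewrite nmulBl nmulVA nmul_suml.
have [ev|ev] := eqVneq v (source e).
  rewrite (bigD1_seq e) ?ees //= -nmulA nmulA'A eqxx nmulAV eqxx.
  rewrite big1 ?addr0 ?subrr // => f /negPf fe.
  by rewrite -nmulA nmulA'A fe nmul0r.
rewrite big1_seq ?subr0 // => f /= fes; rewrite -nmulA nmulA'A.
have [ef|_] := eqVneq f e; last by rewrite nmul0r.
by rewrite -ef esv ?eqxx in ev.
Qed.

Lemma vertex_nmul_gap v es : {in es, forall e, source e = v} ->
  V v *n gap v es = gap v es.
Proof.
move=> esv; rewrite nmulBr vertex_idem nmul_sumr; congr (_ - _).
by apply: eq_big_seq => e /esv ev; rewrite nmulA nmulVA ev eqxx.
Qed.

Lemma gap_nmul_vertex v es : {in es, forall e, source e = v} ->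
  gap v es *n V v = gap v es.
Proof.
move=> esv; rewrite nmulBl vertex_idem nmul_suml; congr (_ - _).
by apply: eq_big_seq => e /esv ev; rewrite -nmulA nmulA'V ev eqxx.
Qed.

(** The projection annihilates from the right every monomial whose last ghost arrow is accounted for
    in [es]. Once [es] contains the relevant arrows of [s0], only the ghost-free part [x'] of [x] is
    left. *)
Lemma mspan_nmul_gap n k x : mspan n k x ->
  exists (s0 : seq (arrow G)) x', pspan `|n|%N x' /\
    forall v es, uniq es -> {in es, forall e, source e = v} ->
    (forall e, e \in s0 -> source e = v -> e \in es) ->
    x *n gap v es = x' *n gap v es.
Proof.
elim=> {n k x} [j n k x -> rx|m n k x e _ _ _|n k
   |n k x y _ [r [x' [rx xE]]] _ [s [y' [ry yE]]]
   |n k a x _ [r [x' [rx xE]]]].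
- by exists [::], x.
- exists [:: e], 0; split; first exact: pspan0.
  move=> v es es_uniq esv ees; rewrite -nmulA ghost_nmul_gap ?nmul0l ?nmul0r //.
  by apply: ees; rewrite mem_head.
- by exists [::], 0; split; first exact: pspan0.
- exists (r ++ s), (x' + y'); split; first exact: pspanD.
  move=> v es es_uniq esv ees; rewrite !nmulDl xE ?yE // => e er ev;
    by apply: ees => //; rewrite mem_cat er ?orbT.
- exists r, (a *: x'); split; first exact: pspanZ.
  by move=> v es es_uniq esv ees; rewrite -!nscalerAl xE.
Qed.

(* The image of [gap v es] behaves like a sink when [phi] kills the arrows of
   source [v] outside [es]. *)
Definition gap_vanishing := forall v es,
  uniq es -> {in es, forall e, source e = v} -> ~ (exists fs, regular v fs) ->
  (forall f, source f = v -> f \notin es -> phi (A f) = 0) ->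
  phi (gap v es) = 0.

Hypothesis phi_gap : gap_vanishing.

(** If every product died, then at a regular vertex CK2 would kill [x] itself. At an irregular
    vertex the whole image of [x] at [v] sits on a gap projection, where [x] has no ghosts; this
    forces the arrows outside [es] into the kernel, and then [phi_gap] applies. *)
Lemma arrow_reduce n k x : mspan n k x -> phi x != 0 ->
  exists f, phi (x *n A f) != 0.
Proof.
move=> mx nz; apply: contrapT => none.
have xA0 f : phi (x *n A f) = 0.
  by apply: contrapT => /eqP xf; apply: none; exists f.
have [vs xE] := vertex_right_unit x.
move: nz; rewrite {1}xE => /phi_sum_neq0 [v _ nzv].
have [[fs fsv]|v_irr] := pselect (exists fs, regular v fs).
  move/eqP: nzv; apply.
  rewrite (vertex_sum F fsv) nmul_sumr phi_sum big1 // => e _.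
  by rewrite nmulA phiM xA0 nmul0l.
have [s0 [x' [rx' x'E]]] := mspan_nmul_gap mx.
pose es := undup [seq e <- s0 | source e == v].
have es_uniq : uniq es by apply: undup_uniq.
have esv : {in es, forall e, source e = v}.
  by move=> e; rewrite mem_undup mem_filter => /andP[/eqP].
have {}x'E : x *n gap v es = x' *n gap v es.
  by apply: x'E => // e es0 /eqP ev; rewrite mem_undup mem_filter ev.
have gx : phi (x' *n gap v es) != 0.
  rewrite -x'E nmulBr phiB nmul_sumr phi_sum big1 ?subr0 // => e _.
  by rewrite nmulA phiM xA0 nmul0l.
have gapE := vertex_nmul_gap esv.
have x'v : phi (x' *n V v) != 0.
  by apply: contra_neq gx => x'v; rewrite -gapE nmulA phiM x'v nmul0l.
(* Reducing [x'] to a nonzero multiple of [v] turns the vanishing of all [phi (x *n A f)] into the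
   vanishing of [phi (A f)] for [f] outside [es]. *)
have [a [w [c [c0 aE w0 _ _]]]] := pspan_reduce (pspan_nmul_vertex v rx') x'v.
have wv : w = v.
  apply: contrapT => /eqP/negPf wv; move/eqP: w0; apply.
  have : (c *: V w) *n V v = c *: V w by rewrite -aE -!nmulA vertex_idem.
  rewrite -nscalerAl nmulVV wv scaler0 => /esym.
  by move/eqP; rewrite scaler_eq0 (negPf c0) => /eqP->; rewrite phi0.
move/eqP: gx; apply; rewrite phiM phi_gap ?nmul0r // => f fv fes.
have : phi (c *: (V v *n A f)) = 0.
  rewrite -{1}wv nscalerAl -aE -!nmulA nmulVA fv eqxx.
  rewrite -(gap_nmul_arrow fv fes) (nmulA x') -x'E -nmulA gap_nmul_arrow //.
  by rewrite phiM xA0 nmul0r.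
move/eqP; rewrite phiZ scaler_eq0 (negPf c0) => /eqP.
by rewrite nmulVA fv eqxx.
Qed.

Lemma arrows_reduce N n k x : mspan n k x -> phi x != 0 ->
  exists b, phi (x *n b) != 0 /\
    forall n' k' x', mspan n' k' x' -> mspan (n' + N%:Z) (k' - N)%N (x' *n b).
Proof.
move=> mx nz; elim: N => [|N [b [nzb IH]]].
  have [vs xE] := vertex_right_unit x.
  move: nz; rewrite {1}xE => /phi_sum_neq0 [v _ nzv].
  exists (V v); split=> // n' k' x' mx'; rewrite addr0 subn0.
  exact: mspan_nmul_vertex.
have [f nzf] := arrow_reduce (IH _ _ _ mx) nzb.
exists (b *n A f); split; first by rewrite nmulA.
move=> n' k' x' /IH /(mspan_nmul_arrow f).
by rewrite nmulA subnS -addrA -PoszD addn1.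
Qed.

(** A common right factor clears the ghosts of all components at once; then a left factor is chosen
    for the lowest component still alive under [phi]. Lower components die only under [phi], while
    the higher ones become genuine combinations of paths in the corner at [w]. *)
Lemma family_reduce (ns : seq nat) (d : int) (x : nat -> L) i0 :
  {in ns, forall i, lpa_homog (d + i%:Z) (x i)} ->
  i0 \in ns -> phi (x i0) != 0 ->
  exists a b w m, [/\ m \in ns, phi (V w) != 0, a *n x m *n b = V w,
    {in ns, forall i, (i < m)%N -> phi (a *n x i *n b) = 0}
    & {in ns, forall i, (m < i)%N -> pspan (i - m) (a *n x i *n b) /\
         V w *n (a *n x i *n b) *n V w = a *n x i *n b}].
Proof.
move=> hx i0ns nz.
have [k mx] : exists k, {in ns, forall i, mspan (d + i%:Z) k (x i)}.
  elim: ns hx {i0ns} => [|i ns IH] hx; first by exists 0%N.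
  have [k1 m1] := homog_mspan (hx i (mem_head _ _)).
  have [j jns|k2 m2] := IH; first by apply: hx; rewrite in_cons jns orbT.
  exists (maxn k1 k2) => j; rewrite in_cons => /predU1P[->|/m2 m2'].
    by apply: mspan_leq m1; rewrite leq_max leqnn.
  by apply: mspan_leq m2'; rewrite leq_max leqnn orbT.
(* [k] arrows remove the ghosts, and [|d|] further ones make every degree nonnegative. *)
pose N := (k + `|d|)%N; pose D := absz (d + N%:Z)%R.
have DE : d + N%:Z = D%:Z.
  rewrite /D gez0_abs // /N PoszD addrCA; apply: addr_ge0 => //.
  by rewrite abszE addrC -[X in _ + X]opprK subr_ge0 -normrN ler_norm.
have [b [nzb mb]] := arrows_reduce N (mx _ i0ns) nz.
have rb i : i \in ns -> pspan (D + i) (x i *n b).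
  move=> /mx/mb; rewrite addrAC DE -PoszD.
  have -> : (k - N)%N = 0%N by apply/eqP; rewrite subn_eq0 leq_addr.
  exact: mspan0_pspan.
have ex_m : exists m, (m \in ns) && (phi (x m *n b) != 0).
  by exists i0; rewrite i0ns.
have [m /andP[mns nzm] m_min] := ex_minnP ex_m.
have [a [w [c [c0 aE w0 _ ra]]]] := pspan_reduce (rb _ mns) nzm.
exists (c^-1 *: (V w *n a)), (b *n V w), w, m.
have ab y : c^-1 *: (V w *n a) *n y *n (b *n V w) =
    V w *n (c^-1 *: (a *n (y *n b))) *n V w.
  by rewrite !nmulA -!nscalerAl -!nscalerAr !nmulA -!nscalerAl.
split=> // [|i ins lt_im|i ins lt_mi].
- by rewrite ab aE scalerA mulVf // scale1r !vertex_idem.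
- rewrite ab !phiM phiZ phiM; have [->|nzi] := eqVneq (phi (x i *n b)) 0.
    by rewrite nmul0r scaler0 nmul0r nmul0l.
  by have := m_min i; rewrite ins nzi leqNgt lt_im => /(_ isT).
- rewrite ab; split.
    apply/pspan_nmul_vertex/vertex_nmul_pspan/pspanZ/ra.
    by rewrite -addnA subnKC ?(ltnW lt_mi) //; apply: rb.
  by rewrite !nmulA vertex_idem -!nmulA vertex_idem.
Qed.

End Reduction.

(** * Finite-dimensional corners from a non-graded kernel *)

Section FiniteCorner.
Variables (F : fieldType) (G : digraph) (B : nuAlgType F).
Variable phi : leavitt F G -> B.
Hypothesis phi_hom : algebra_hom phi.
Local Notation L := (leavitt F G).
Local Notation V v := (lpa_of F (@Vertex G v)).
Local Notation A e := (lpa_of F (@Arrow G e)).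
Local Notation A' e := (lpa_of F (@Ghost G e)).
Implicit Types (u v w : vertex G) (e f : arrow G) (x y z : L).

Let phi0 := algebra_hom0 phi_hom.
Let phiD := algebra_homD phi_hom.
Let phiN := algebra_homN phi_hom.
Let phiB := algebra_homB phi_hom.
Let phiZ := algebra_homZ phi_hom.
Let phiM := algebra_homM phi_hom.
Let phi_sum := algebra_hom_sum phi_hom.

Lemma ghost_nmul_pspan_ge k e x : pspan_ge k.+1 x -> pspan_ge k (A' e *n x).
Proof.
elim=> {x} [x [[//|n] kn rx]||x y _ ? _ ?|a x _ ?].
- by apply: pspan_geW (ghost_nmul_pspan e rx).
- by rewrite nmul0r; apply: lspan0.
- by rewrite nmulDr; apply: lspanD.
- by rewrite -nscalerAr; apply: lspanZ.
Qed.

Lemma pspan_ge_left_unit k x : pspan_ge k.+1 x ->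
  left_unit (fun e => A e *n A' e) x.
Proof.
elim=> {x} [x [[//|n] kn rx]||x y _ ? _ ?|a x _ ?].
- exact: pspan_left_unit rx.
- exact: left_unit0.
- exact: left_unitD.
- exact: left_unitZ.
Qed.

(* [p] is a sum of projections [q q^*] onto the finitely many paths [q] of
   length [k] that are prefixes of the paths occurring in [z]. *)
Lemma prefix_projection k z : pspan_ge k z -> exists p (bs : seq L),
  p *n z = z /\ forall x, pspan k x -> lspan (fun y => y \in bs) (p *n x).
Proof.
elim: k z => [|k IH] z rz.
  have [s sE] := left_unit_undup (vertex_left_unit z).
  exists (\sum_(v <- s) V v), [seq V v | v <- s]; split; first by rewrite nmul_suml.
  move=> x rx; rewrite nmul_suml; apply: lspan_sum => v vs.
  have [a ->] := vertex_nmul_pspan0 v rx.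
  by apply/lspanZ/lspan_gen/map_f.
have [s sE] := left_unit_undup (pspan_ge_left_unit rz).
have /choice[p pP] e := IH _ (ghost_nmul_pspan_ge e rz).
have {pP} /choice[bs pP] := pP.
exists (\sum_(e <- s) A e *n p e *n A' e),
  (flatten [seq [seq A e *n b | b <- bs e] | e <- s]); split.
  rewrite nmul_suml -{2}sE; apply: eq_bigr => e _.
  by rewrite -!nmulA (pP e).1.
move=> x rx; rewrite nmul_suml; apply: lspan_sum => e es; rewrite -!nmulA.
elim: ((pP e).2 _ (ghost_nmul_pspan e rx)) => [y ybs||y1 y2 _ ? _ ?|a y _ ?].
- apply: lspan_gen; apply/flattenP; exists [seq A e *n b | b <- bs e].
    exact: (map_f (fun e => [seq A e *n b | b <- bs e])).
  exact: map_f.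
- by rewrite nmul0r; apply: lspan0.
- by rewrite nmulDr; apply: lspanD.
- by rewrite -nscalerAr; apply: lspanZ.
Qed.

(** Paths of length at least [k] are long enough to absorb at most [k] ghost arrows. *)
Lemma mspan_nmul_pspan_ge n k x z : mspan n k x -> pspan_ge k z ->
  pspan_ge 0 (x *n z).
Proof.
move=> mx; elim=> {z} [z [j kj rz]||z1 z2 _ ? _ ?|a z _ ?].
- elim: mx j z kj rz => {n k x} [i n k x _ rx|m n k x e _ _ IH|n k
    |n k x y _ IHx _ IHy|n k a x _ IH] j z kj rz.
  + by apply: pspan_geW (pspan_nmul rx rz).
  + case: j kj rz => [//|j] kj rz; rewrite -nmulA.
    by apply: IH (ghost_nmul_pspan e rz).
  + by rewrite nmul0l; apply: lspan0.
  + by rewrite nmulDl; apply: lspanD; [apply: IHx rz|apply: IHy rz].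
  + by rewrite -nscalerAl; apply: lspanZ; apply: IH rz.
- by rewrite nmul0r; apply: lspan0.
- by rewrite nmulDr; apply: lspanD.
- by rewrite -nscalerAr; apply: lspanZ.
Qed.

(** * A vertex congruent to a sum of paths of positive length *)

Section CyclicCorner.
Variables (w : vertex G) (T : seq nat) (deg : nat -> nat) (y : nat -> L).
Variables (n : nat) (u : L).
Hypotheses (T_uniq : uniq T) (nT : n \in T)
  (yP : {in T, forall i, pspan (deg i) (y i)})
  (deg_gt0 : {in T, forall i, (0 < deg i)%N})
  (wy : {in T, forall i, V w *n y i = y i})
  (w_sum : phi (V w) = - \sum_(i <- T) phi (y i))
  (wu : V w *n u = u) (yu : phi (y n *n u) = phi (V w))
  (uP : forall m z, pspan (deg n + m) z -> pspan m (u *n z))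
  (n_top : {in T, forall i, i != n -> (deg i < deg n)%N \/ phi (y i) = 0}).

(** Each substitution of [w_sum] into itself lengthens all paths by at least one. *)
Lemma vertex_pspan_ge k : exists2 z, pspan_ge k z & phi z = phi (V w).
Proof.
elim: k => [|k [z rz zE]].
  by exists (V w) => //; apply: pspan_geW (pspan_vertex F w).
exists (- \sum_(i <- T) y i *n z).
  apply/lspanN/lspan_sum => i iT; rewrite -(add1n k); apply: pspan_ge_nmul => //.
  by apply: pspan_geW (yP iT); apply: deg_gt0.
by rewrite -nmul_suml phiN phiM phi_sum zE -nmulNl -w_sum -phiM vertex_idem.
Qed.

(** Replace [w] by a combination [z] of paths of length at least [k]. The prefix projection [p] of
    [z] then fixes [phi (V w)] from the left, so only finitely many paths of length [k]
    contribute. *)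
Lemma pspan_corner_fin k : exists bs : seq B, forall j x,
  (j < k)%N -> pspan j x ->
  lspan (fun b => b \in bs) (phi (V w *n x)).
Proof.
elim: k => [|k [bs bsP]]; first by exists [::].
have [z rz zE] := vertex_pspan_ge k.
have [p [cs [pz csP]]] := prefix_projection rz.
exists (bs ++ map phi cs) => j x; rewrite ltnS leq_eqVlt => /predU1P[->|jk] rx.
  have wE : phi (V w) = phi p *n phi (V w) by rewrite -zE -{1}pz phiM.
  have wwx : V w *n (V w *n x) = V w *n x by rewrite nmulA vertex_idem.
  have -> : phi (V w *n x) = phi (p *n (V w *n x)).
    by rewrite -[in LHS]wwx phiM wE -nmulA -!phiM wwx.
  apply: lspan_sub (algebra_hom_lspan phi_hom (csP _ (vertex_nmul_pspan w rx))).
  by move=> b bcs; apply: lspan_gen; rewrite mem_cat bcs orbT.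
apply: lspan_sub (bsP _ _ jk rx) => b bbs.
by apply: lspan_gen; rewrite mem_cat bbs.
Qed.

(** Modulo the kernel [x] equals [y n *n (u *n x)] at [w]. Solving [w_sum] for the top term [y n]
    rewrites this by strictly shorter paths, so those of length below [deg n] span everything. *)
Lemma vertex_finite_corner : exists bs : seq B, forall x,
  lspan (fun b => b \in bs) (phi (V w *n x *n V w)).
Proof.
have [bs bsP] := pspan_corner_fin (deg n); exists bs.
have yn : phi (y n) = - phi (V w) - \sum_(i <- T | i != n) phi (y i).
  by rewrite w_sum opprK (bigD1_seq n) //= addrK.
have span j x : pspan j x -> lspan (fun b => b \in bs) (phi (V w *n x)).
  elim/ltn_ind: j x => j IH x rx.
  have [|le_nj] := ltnP j (deg n); first by move/bsP; apply.
  have rux : pspan (j - deg n) (u *n x) by apply: uP; rewrite subnKC.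
  have -> : phi (V w *n x) = - phi (V w *n (u *n x))
      - \sum_(i <- T | i != n) phi (V w *n (y i *n (u *n x))).
    rewrite phiM -yu -phiM -nmulA phiM yn nmulBl nmulNl -phiM nmul_suml.
    congr (_ - _); rewrite big_seq_cond [RHS]big_seq_cond.
    by apply: eq_bigr => i /andP[iT _]; rewrite -phiM (nmulA (V w)) wy.
  apply: lspanD; apply: lspanN.
    apply: IH rux; rewrite ltn_subrL (leq_trans _ le_nj) ?deg_gt0 //.
  rewrite -big_filter; apply: lspan_sum => i; rewrite mem_filter => /andP[ni iT].
  have [lt_in|yi0] := n_top iT ni.
    apply: IH (pspan_nmul (yP iT) rux).
    by rewrite -{2}(subnKC le_nj) ltn_add2r.
  by rewrite nmulA wy // phiM yi0 nmul0l; apply: lspan0.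
have span_ge x : pspan_ge 0 x -> lspan (fun b => b \in bs) (phi (V w *n x)).
  elim=> {x} [x [j _ /span]//||x z _ ? _ ?|a x _ ?].
  - by rewrite nmul0r phi0; apply: lspan0.
  - by rewrite nmulDr phiD; apply: lspanD.
  - by rewrite -nscalerAr phiZ; apply: lspanZ.
move=> x; have [d [K [z [hz ->]]]] := leavitt_sum x.
rewrite nmul_sumr nmul_suml phi_sum; apply: lspan_sum => i _.
have [k mz] := homog_mspan (hz i).
(* Trading the right-hand [w] for long paths absorbs the ghosts of [z i]. *)
have [t rt tE] := vertex_pspan_ge k.
rewrite phiM -tE -phiM -nmulA; apply: span_ge.
exact: mspan_nmul_pspan_ge mz rt.
Qed.

End CyclicCorner.

Hypothesis phi_gap : gap_vanishing phi.
Hypothesis phi_corner : forall w, phi (V w) != 0 ->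
  ~ exists bs : seq B, forall x,
    lspan (fun b => b \in bs) (phi (V w *n x *n V w)).

Lemma vertex_absorb v w (c : F) x : c != 0 -> phi (V w) != 0 ->
  x *n V v = x -> x = c *: V w -> v = w.
Proof.
move=> c0 w0 xv xE; apply: contrapT => /eqP/negPf vw; move/eqP: w0; apply.
move: xv; rewrite xE -nscalerAl nmulVV eq_sym vw scaler0 => /esym/eqP.
by rewrite scaler_eq0 (negPf c0) => /eqP ->.
Qed.

(* Induction on the number of components.  After [family_reduce] the sum is
   [V w + \sum_T y i].  For homogeneous [s] in the corner at [w] the degree-0
   term drops out of the commutator of [s] with this sum, so by induction the
   [y i] are central modulo the kernel; hence the top one is invertible. *)
Lemma sum_ker (ns : seq nat) (d : int) (x : nat -> L) : uniq ns ->
  {in ns, forall i, lpa_homog (d + i%:Z) (x i)} ->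
  phi (\sum_(i <- ns) x i) = 0 -> {in ns, forall i, phi (x i) = 0}.
Proof.
have [N] := ubnP (size ns); elim: N ns d x => //.
move=> N IH ns d x szN ns_uniq hx sum0.
move=> i0 i0ns; apply: contrapT => /eqP nz.
have [a [b [w [m [mns w0 abw ab0 abP]]]]] :=
  family_reduce phi_hom phi_gap hx i0ns nz.
have [y yE] : exists y : nat -> L, forall i, y i = a *n x i *n b by eexists.
pose T := [seq i <- ns | (m < i)%N].
have TP i : i \in T -> i \in ns /\ (m < i)%N by rewrite mem_filter => /andP[].
have T_uniq : uniq T by apply: filter_uniq.
have ry : {in T, forall i, pspan (i - m) (y i)}.
  by move=> i /TP[] /abP H /H[]; rewrite yE.
have wyw : {in T, forall i, V w *n y i *n V w = y i}.
  by move=> i /TP[] /abP H /H[]; rewrite yE.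
have wy : {in T, forall i, V w *n y i = y i}.
  by move=> i iT; rewrite -{1}(wyw i iT) !nmulA vertex_idem wyw.
have yw : {in T, forall i, y i *n V w = y i}.
  by move=> i iT; rewrite -{1}(wyw i iT) -!nmulA vertex_idem !nmulA wyw.
have w_sum : phi (V w) = - \sum_(i <- T) phi (y i).
  apply/eqP; rewrite -addr_eq0 -abw -yE; apply/eqP.
  have sumE : phi (a *n (\sum_(i <- ns) x i) *n b) = 0.
    by rewrite !phiM sum0 nmul0r nmul0l.
  rewrite -[RHS]sumE nmul_sumr nmul_suml phi_sum.
  under [RHS]eq_bigr => i _ do rewrite -yE.
  by rewrite (sum_above ns_uniq mns) // => i ins /ab0; rewrite yE; apply.
have szT : (size T < N)%N.
  rewrite size_filter; apply: leq_trans (szN : (size ns <= N)%N).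
  rewrite -(count_predC (fun i => m < i)%N ns) -addn1 leq_add2l -has_count.
  by apply/hasP; exists m; rewrite //= ltnn.
have comm (k : int) s : lpa_homog k s -> V w *n s = s -> s *n V w = s ->
    {in T, forall i, phi (s *n y i) = phi (y i *n s)}.
  move=> hs ws sw i iT; apply/eqP; rewrite -subr_eq0 -phiB; apply/eqP.
  apply: (IH T (k - m%:Z) (fun i => s *n y i - y i *n s)) => // [j jT|].
    have hy : lpa_homog (j%:Z - m%:Z) (y j).
      by rewrite subzn ?(ltnW (TP _ jT).2) //; apply/pspan_homog/ry.
    apply: homog_add; last apply: homogN.
      by apply: lpa_homog_cast (homog_mul hs hy); rewrite -addrA (addrC (- _)).
    by apply: lpa_homog_cast (homog_mul hy hs); rewrite addrC addrA addrAC.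
  rewrite sumrB -nmul_sumr -nmul_suml phiB !phiM phi_sum.
  have -> : \sum_(i <- T) phi (y i) = - phi (V w) by rewrite w_sum opprK.
  by rewrite nmulNl nmulNr -!phiM ws sw subrr.
have ex_n : exists n, (n \in T) && (phi (y n) != 0).
  apply: contrapT => none; move/eqP: w0; apply; rewrite w_sum big1_seq ?oppr0 //.
  move=> i /= iT; apply: contrapT => /eqP yi; apply: none; exists i.
  by rewrite iT yi.
have T_bound i : (i \in T) && (phi (y i) != 0) -> (i <= \max_(i <- T) i)%N.
  by case/andP=> iT _; apply: leq_bigmax_seq.
have [n /andP[nT yn0] n_max] := ex_maxnP ex_n T_bound.
have [c [v [k [k0 cE v0 hc rc]]]] := pspan_reduce phi_hom (ry _ nT) yn0.
have wv : w = v by apply: (vertex_absorb k0 v0 _ cE); rewrite -nmulA yw.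
subst v; pose u := k^-1 *: (V w *n c *n V w).
have wu : V w *n u = u by rewrite /u -nscalerAr !nmulA vertex_idem.
have uw : u *n V w = u by rewrite /u -nscalerAl -!nmulA vertex_idem.
have uy : u *n y n = V w.
  rewrite /u -nscalerAl -!nmulA wy // cE -nscalerAr vertex_idem scalerA mulVf //.
  by rewrite scale1r.
have hu : lpa_homog (- (n - m)%N%:Z) u.
  by apply/homog_scale/homog_nmul_vertex/homog_vertex_nmul.
apply: (phi_corner w0).
apply: (@vertex_finite_corner w T (fun i => i - m)%N y n u) => //.
- by move=> i /TP[_]; rewrite subn_gt0.
(* By construction [u] is only a left inverse of [y n]; centrality modulo the kernel makes it a
   right inverse. *)
- by rewrite -(comm _ _ hu) // uy.
- move=> j z rz; rewrite /u -nscalerAl -!nmulA.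
  by apply/pspanZ/vertex_nmul_pspan/rc/vertex_nmul_pspan.
- move=> i iT ni; have [yi|yi] := eqVneq (phi (y i)) 0; first by right.
  left; apply: ltn_sub2r; first exact: (TP _ nT).2.
  by rewrite ltn_neqAle ni n_max ?iT.
Qed.

Lemma ker_graded : graded_ideal (ker phi).
Proof.
split; first exact: ker_ideal.
move=> x x0; have [d [K [y [hy xE]]]] := leavitt_sum x.
have y0 := sum_ker (iota_uniq 0 K)
  (fun i _ => hy i) (etrans (congr1 phi (esym xE)) x0).
pose z (n : int) := if (d <= n) && (`|n - d| < K)%N then y `|n - d|%N else 0.
have dK (i : nat) : absz (d + i%:Z - d)%R = i by rewrite addrC addKr.
exists [seq d + i%:Z | i : nat <- iota 0 K], z; split.
- by rewrite map_inj_uniq ?iota_uniq // => i j /addrI[].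
- move=> n; rewrite /z /ker /=; case: ifP => [/andP[dn nK]|_]; last first.
    by split; [apply: homog_zero|exact: phi0].
  split; last by apply: y0; rewrite mem_iota.
  apply: lpa_homog_cast (hy _).
  by rewrite gez0_abs ?subr_ge0 // addrCA subrr addr0.
- rewrite xE big_map; apply: eq_big_seq => i; rewrite mem_iota add0n => /= iK.
  by rewrite /z dK iK lerDl.
Qed.

End FiniteCorner.

(** * Nonvanishing through infinite paths *)

Section InfinitePathModule.
Variables (F : fieldType) (G : digraph).
Local Notation L := (leavitt F G).
Local Notation V v := (lpa_of F (@Vertex G v)).
Implicit Types (u v w : vertex G) (e : arrow G) (x y z : L).

Definition infinite_path (p : nat -> arrow G) : bool :=
  `[< forall i, target (p i) = source (p i.+1) >].

Definition ptail (p : nat -> arrow G) : nat -> arrow G := fun i => p i.+1.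

Definition pcons e (p : nat -> arrow G) : nat -> arrow G :=
  fun i => if i is j.+1 then p j else e.

Lemma infinite_path_tail p : infinite_path p -> infinite_path (ptail p).
Proof. by move/asboolP=> pP; apply/asboolP => i; apply: pP. Qed.

Lemma infinite_path_cons e p : infinite_path p -> target e = source (p 0%N) ->
  infinite_path (pcons e p).
Proof. by move/asboolP=> pP ep; apply/asboolP => -[|i] //=. Qed.

(* The Leavitt path algebra acts on functions of an infinite path and of an
   integer; the integer records the degree. *)
Local Notation M := ((nat -> arrow G) -> int -> F).

(** An arrow prepends itself to an infinite path and raises the degree, written on functions as a
    pullback. The guards send everything to functions vanishing off the infinite paths, so all arrow
    sequences may be allowed as arguments. *)
Definition gen_act (g : lpa_gen G) (f : M) : M := fun p n =>
  match g with
  | Vertex v => if infinite_path p && (source (p 0%N) == v) then f p n else 0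
  | Arrow e => if infinite_path p && (p 0%N == e) then f (ptail p) (n - 1) else 0
  | Ghost e => if infinite_path p && (source (p 0%N) == target e)
               then f (pcons e p) (n + 1) else 0
  end.

Fixpoint term_act (t : term F (lpa_gen G)) (f : M) : M :=
  match t with
  | Gen g => gen_act g f
  | Zero => fun _ _ => 0
  | Opp s => fun p n => - term_act s f p n
  | Add s t => fun p n => term_act s f p n + term_act t f p n
  | Scale a s => fun p n => a * term_act s f p n
  | Mul s t => term_act s (term_act t f)
  end.

(** Additivity in the function is what distributivity over a sum in the right factor requires. *)
Lemma term_actD t (f g : M) p n :
  term_act t (fun p n => f p n + g p n) p n = term_act t f p n + term_act t g p n.
Proof.
elim: t f g p n => [[v|e|e]||s IHs|s IHs t IHt|a s IHs|s IHs t IHt] f g p n /=;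
  rewrite ?addr0 //.
- by case: ifP; rewrite ?addr0.
- by case: ifP; rewrite ?addr0.
- by case: ifP; rewrite ?addr0.
- by rewrite IHs opprD.
- by rewrite IHs IHt addrACA.
- by rewrite IHs mulrDr.
- rewrite -IHs; congr (term_act s _ p n).
  by apply/funext => q; apply/funext => m; apply: IHt.
Qed.

Lemma term_actZ t (a : F) (f : M) p n :
  term_act t (fun p n => a * f p n) p n = a * term_act t f p n.
Proof.
elim: t f p n => [[v|e|e]||s IHs|s IHs t IHt|b s IHs|s IHs t IHt] f p n /=;
  rewrite ?mulr0 //.
- by case: ifP; rewrite ?mulr0.
- by case: ifP; rewrite ?mulr0.
- by case: ifP; rewrite ?mulr0.
- by rewrite IHs mulrN.
- by rewrite IHs IHt mulrDr.
- by rewrite IHs mulrCA.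
- rewrite -IHs; congr (term_act s _ p n).
  by apply/funext => q; apply/funext => m; apply: IHt.
Qed.

Lemma pcons_tail p : pcons (p 0%N) (ptail p) = p.
Proof. by apply/funext => -[|i]. Qed.

Lemma term_act_rel s t : lpa_rel s t ->
  forall f p n, term_act s f p n = term_act t f p n.
Proof.
case=> {s t} [u v|e|e|e|e|e e'|v es es_uniq esP _] f p n.
- rewrite (fun_if (fun t => term_act t f p n)) /=.
  case: (infinite_path p) => /=; last by case: ifP.
  have [pu|pu] := eqVneq (source (p 0%N)) u; last by case: ifP.
  by rewrite pu.
- rewrite /=; case: (infinite_path p) => //=.
  case: (eqVneq (p 0%N) e) => [->|_]; first by rewrite eqxx.
  by case: ifP.
- rewrite /=; have [p_inf|//] := boolP (infinite_path p).
  rewrite infinite_path_tail //=.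
  have [pe|//] := eqVneq (p 0%N) e.
  have pt : target (p 0%N) = source (p 1%N) by exact: (asboolW p_inf).
  by rewrite -pt pe eqxx.
- by rewrite /=; case: (infinite_path p); case: (source _ == _).
- rewrite /=; have [p_inf|//] := boolP (infinite_path p) => /=.
  case: ifP => // /eqP pe.
  by rewrite infinite_path_cons //= eqxx.
- rewrite (fun_if (fun t => term_act t f p n)) /=.
  have [p_inf|_] := boolP (infinite_path p) => /=; last by case: ifP.
  case: ifP => [/eqP pe|_]; last by case: ifP.
  by rewrite infinite_path_cons //= addrK.
- have -> : term_act (foldr (fun e t => Add (Mul (Gen (Arrow e)) (Gen (Ghost e))) t)
      Zero es) f p n =
      \sum_(e <- es) if infinite_path p && (p 0%N == e) then f p n else 0.
    elim: es {es_uniq esP} => [|e es IH]; first by rewrite big_nil.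
    rewrite big_cons -IH /=; congr (_ + _).
    have [p_inf|//] := boolP (infinite_path p).
    have [pe|//] := eqVneq (p 0%N) e.
  have pt : target (p 0%N) = source (p 1%N) by exact: (asboolW p_inf).
    by rewrite infinite_path_tail //= -pe pcons_tail pt eqxx subrK.
  (* CK2 holds because an infinite path from [v] starts with exactly one arrow of [es]. *)
  rewrite /=; have [p_inf|_] := boolP (infinite_path p) => /=; last by rewrite big1.
  case: eqP => [pv|pv].
    rewrite (bigD1_seq (p 0%N)) ?esP //= eqxx big1 ?addr0 // => e /negPf ne.
    by rewrite eq_sym ne.
  rewrite big1_seq // => e /= /esP ev.
  by case: eqP => // pe; case: pv; rewrite pe.
Qed.

Lemma term_act_congr s t : congr (@lpa_rel F G) s t ->
  forall f p n, term_act s f p n = term_act t f p n.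
Proof.
elim=> {s t} [s t /term_act_rel//|//|s t _ IH f p n|s t r _ IH1 _ IH2 f p n
  |s s' _ IH f p n|s s' t t' _ IH1 _ IH2 f p n|a s s' _ IH f p n
  |s s' t t' _ IH1 _ IH2 f p n|*|*|*|*|*|*|*|*|*|*|*|*|*] /=.
- by rewrite IH.
- by rewrite IH1.
- by rewrite IH.
- by rewrite IH1 IH2.
- by rewrite IH.
- rewrite IH1; congr (term_act s' _ p n).
  by apply/funext => q; apply/funext => m; apply: IH2.
- by rewrite addrA.
- by rewrite addrC.
- by rewrite add0r.
- by rewrite addNr.
- by rewrite mulrA.
- by rewrite mul1r.
- by rewrite mulrDr.
- by rewrite mulrDl.
- by [].
- by [].
- exact: term_actD.
- by [].
- by rewrite term_actZ.
Qed.

Definition act (x : L) : M -> M := term_act (repr x).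

Lemma act_cls t f p n : act (cls (@lpa_rel F G) t) f p n = term_act t f p n.
Proof. exact/term_act_congr/congr_repr. Qed.

Lemma act_gen g f p n : act (lpa_of F g) f p n = gen_act g f p n.
Proof. exact: act_cls. Qed.

Lemma act0 f p n : act 0 f p n = 0.
Proof. exact: (act_cls Zero). Qed.

Lemma actD x y f p n : act (x + y) f p n = act x f p n + act y f p n.
Proof. by elim/cls_ind: x => s; elim/cls_ind: y => t; rewrite clsD !act_cls. Qed.

Lemma actZ a x f p n : act (a *: x) f p n = a * act x f p n.
Proof. by elim/cls_ind: x => s; rewrite clsZ !act_cls. Qed.

Lemma actM x y f p n : act (x *n y) f p n = act x (act y f) p n.
Proof.
elim/cls_ind: x => s; elim/cls_ind: y => t; rewrite nmul_cls !act_cls /=.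
congr (term_act s _ p n).
by apply/funext => q; apply/funext => m; rewrite act_cls.
Qed.

Lemma act_pspan j x : pspan j x -> forall (f : M) p n,
  (forall q m, m != 0 -> f q m = 0) -> n != j%:Z -> act x f p n = 0.
Proof.
elim=> {j x} [v|j e x _ IH|j|j x y _ IHx _ IHy|j a x _ IH] f p n f0 nj.
- by rewrite act_gen /=; case: ifP => // _; apply: f0.
- rewrite actM act_gen /=; case: ifP => // _; apply: IH => //.
  by rewrite subr_eq addrC -intS.
- exact: act0.
- by rewrite actD IHx ?IHy ?addr0.
- by rewrite actZ IH ?mulr0.
Qed.

Hypothesis no_sink : forall v, ~ sink v.

Lemma out_arrow v : exists e, source e = v.
Proof.
apply: contrapT => none; apply: (no_sink (v := v)); apply/seteqP; split=> // e ev.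
by apply: none; exists e.
Qed.

Lemma infinite_path_from v : exists2 p, infinite_path p & source (p 0%N) = v.
Proof.
have /choice[nxt nxtP] := out_arrow.
exists (fun i => iter i (fun e => nxt (target e)) (nxt v)) => //=.
by apply/asboolP => i /=; rewrite nxtP.
Qed.

(** Apply the sum to the function that is 1 in degree 0 and evaluate in degree 0 at an infinite path
    from [v]: paths of positive length have moved the support away, and [a] remains. *)
Lemma vertex_add_pspan_ge (a : F) v y : pspan_ge 1 y -> a *: V v + y = 0 -> a = 0.
Proof.
move=> ry vy0; have [p p_inf pv] := infinite_path_from v.
pose f : M := fun _ n => (n == 0)%:R.
have f0 q m : m != 0 -> f q m = 0 by rewrite /f => /negPf ->.
have fy : act y f p 0 = 0.
  elim: ry => {y vy0} [y [j j1 ry]||x y _ IHx _ IHy|b y _ IH].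
  - by apply: act_pspan ry _ _ _ f0 _; case: j j1.
  - exact: act0.
  - by rewrite actD IHx IHy addr0.
  - by rewrite actZ IH mulr0.
have : act (a *: V v + y) f p 0 = 0 by rewrite vy0 act0.
by rewrite actD fy addr0 actZ act_gen /= p_inf pv eqxx /f eqxx mulr1.
Qed.

Lemma vertex_neq0 v : V v != 0.
Proof.
apply/eqP => v0; have /eqP := oner_neq0 F; apply.
by apply: (@vertex_add_pspan_ge 1 v 0); [apply: lspan0|rewrite v0 scaler0 addr0].
Qed.

End InfinitePathModule.

(** * Independent elements in the corner at a vertex *)

Section Paths.
Variables (F : fieldType) (G : digraph).
Local Notation L := (leavitt F G).
Local Notation V v := (lpa_of F (@Vertex G v)).
Local Notation A e := (lpa_of F (@Arrow G e)).
Local Notation A' e := (lpa_of F (@Ghost G e)).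
Implicit Types (u v w : vertex G) (e f : arrow G) (p q : seq (arrow G)).
Implicit Types (x y z : L).

Lemma path_from_cons u e p :
  path_from u (e :: p) <-> source e = u /\ path_from (target e) p.
Proof.
case: p => [|f p] /=; first by split=> -[].
split=> [[-> /andP[/eqP-> ?]]//|[-> [<- ?]]].
by rewrite eqxx.
Qed.

Lemma path_from_cat u p q :
  path_from u (p ++ q) <-> path_from u p /\ path_from (path_target u p) q.
Proof.
elim: p u => [|e p IH] u; first by split=> // -[].
rewrite cat_cons !path_from_cons IH /path_target /=.
by split=> [[? []]|[[]]].
Qed.

Lemma path_target_cat u p q :
  path_target u (p ++ q) = path_target (path_target u p) q.
Proof. by rewrite /path_target map_cat last_cat. Qed.

Definition path_elt v p : L := foldr (fun e x => A e *n x) (V v) p.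

Definition ghost_elt v p : L := foldr (fun e x => x *n A' e) (V v) p.

Lemma pspan_path_elt v p : pspan (size p) (path_elt v p).
Proof. by elim: p => [|e p IH]; [apply: pspan_vertex|apply: pspan_arrow]. Qed.

Lemma vertex_path_elt u p : path_from u p ->
  V u *n path_elt (path_target u p) p = path_elt (path_target u p) p.
Proof.
case: p => [_|e p /path_from_cons[<- _]] /=; first exact: vertex_idem.
by rewrite nmulA nmulVA eqxx.
Qed.

Lemma path_elt_vertex v p : path_elt v p *n V v = path_elt v p.
Proof. by elim: p => [|e p IH] /=; rewrite ?vertex_idem // -nmulA IH. Qed.

Lemma ghost_elt_vertex u p : path_from u p ->
  ghost_elt (path_target u p) p *n V u = ghost_elt (path_target u p) p.
Proof.
case: p => [_|e p /path_from_cons[<- _]] /=; first exact: vertex_idem.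
by rewrite -nmulA nmulA'V eqxx.
Qed.

Lemma ghost_path_elt u p : path_from u p ->
  ghost_elt (path_target u p) p *n path_elt (path_target u p) p =
  V (path_target u p).
Proof.
elim: p u => [|e p IH] u /=; first by rewrite vertex_idem.
move=> /path_from_cons[_ ep]; rewrite -nmulA (nmulA (A' e)) nmulA'A eqxx nmulA.
by rewrite (ghost_elt_vertex ep) IH.
Qed.

Lemma ghost_path_elt0 u p q : path_from u p -> path_from u q ->
  size p = size q -> p <> q ->
  ghost_elt (path_target u p) p *n path_elt (path_target u q) q = 0.
Proof.
elim: p u q => [|e p IH] u [|f q] //=.
move=> /path_from_cons[_ ep] /path_from_cons[_ fq] [szpq] pq.
rewrite -nmulA (nmulA (A' e)) nmulA'A.
have [ef|_] := eqVneq e f; last by rewrite nmul0l nmul0r.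
subst f; rewrite nmulA (ghost_elt_vertex ep); apply: IH => // pq'.
by apply: pq; rewrite pq'.
Qed.

Definition independent_corner n v := exists x : 'I_n -> L,
  (forall i, V v *n x i *n V v = x i) /\
  forall c : 'I_n -> F, \sum_i c i *: x i = 0 -> forall i, c i = 0.

Lemma independent_corner_transfer n u v a b : V u *n a = a -> b *n V u = b ->
  b *n a = V v -> independent_corner n v -> independent_corner n u.
Proof.
move=> ua bu ba [x [xv x_free]].
exists (fun i => a *n x i *n b); split=> [i|c sum0].
  by rewrite !nmulA ua -!nmulA bu.
apply: x_free; have sumE : b *n (\sum_i c i *: (a *n x i *n b)) *n a = 0.
  by rewrite sum0 nmul0r nmul0l.
rewrite -[RHS]sumE nmul_sumr nmul_suml; apply: eq_bigr => i _.
by rewrite -nscalerAr -nscalerAl !nmulA ba -!nmulA ba -{1}xv !nmulA.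
Qed.

Section NoSink.
Hypothesis no_sink : forall v, ~ sink v.

(** In a linear relation, [d] on the left kills every [a *n x j *n b], which isolates the
    coefficient of the new element [c *n d]; sandwiching the rest between [b] and [a] returns to the
    corner at [v]. *)
Lemma independent_corner_branch n u v w a b c d :
  V u *n a = a -> b *n V u = b -> b *n a = V v ->
  V u *n c = c -> d *n V u = d -> d *n c = V w -> d *n a = 0 ->
  independent_corner n v -> independent_corner n.+1 u.
Proof.
move=> ua bu ba uc du dc da [x [xv x_free]].
exists (fun i => if unlift ord0 i is Some j then a *n x j *n b else c *n d).
split=> [i|k].
  by case: unliftP => [j|] _; rewrite !nmulA ?ua ?uc -!nmulA ?bu ?du.
rewrite big_ord_recl unlift_none; under eq_bigr => i _ do rewrite liftK.
move=> sum0; have k0 : k ord0 = 0.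
  have : d *n (k ord0 *: (c *n d) +
      \sum_i k (lift ord0 i) *: (a *n x i *n b)) *n c = 0.
    by rewrite sum0 nmul0r nmul0l.
  rewrite nmulDr nmul_sumr big1 => [|i _].
    rewrite addr0 -nscalerAr -nscalerAl nmulA dc -nmulA dc vertex_idem.
    by move/eqP; rewrite scaler_eq0 (negPf (vertex_neq0 F no_sink w)) orbF => /eqP.
  by rewrite -nscalerAr !nmulA da !nmul0l scaler0.
move=> i; case: (unliftP ord0 i) => [j ->|->//].
apply: (x_free (fun j => k (lift ord0 j))).
have sumE : b *n (\sum_i k (lift ord0 i) *: (a *n x i *n b)) *n a = 0.
  by move: sum0; rewrite k0 scale0r add0r => ->; rewrite nmul0r nmul0l.
rewrite -[RHS]sumE nmul_sumr nmul_suml; apply: eq_bigr => l _.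
by rewrite -nscalerAr -nscalerAl !nmulA ba -!nmulA ba -{1}xv !nmulA.
Qed.

(** The constant coefficient of a relation between powers vanishes by degree; the ghost of the
    closed path then lowers all remaining powers by one. *)
Lemma independent_corner_cycle n v p : path_from v p -> path_target v p = v ->
  p <> [::] -> independent_corner n v.
Proof.
move=> vp pv p0; have vR := vertex_path_elt vp; have SR := ghost_path_elt vp.
rewrite pv in vR SR; have Rv := path_elt_vertex v p.
have rR : pspan_ge 1 (path_elt v p).
  by apply: pspan_geW (pspan_path_elt v p); case: p p0 {vp pv vR SR Rv}.
move: (path_elt v p) (ghost_elt v p) vR SR Rv rR => R S vR SR Rv rR.
pose x i := iter i (fun y => R *n y) (V v).
have vx i : V v *n x i = x i by case: i => [|i] /=; rewrite ?vertex_idem // nmulA vR.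
have xv i : x i *n V v = x i.
  by elim: i => [|i IH] /=; rewrite ?vertex_idem // -nmulA IH.
have rx i : pspan_ge 0 (x i).
  elim: i => [|i IH] /=; first by apply: pspan_geW (pspan_vertex F v).
  by apply: lspan_sub (pspan_ge_nmul rR IH) => y [j _ ry]; apply: pspan_geW ry.
exists (fun i => x i); split=> [i|]; first by rewrite vx xv.
elim: n => [c _ []//|n IH] c; rewrite big_ord_recl /= => sum0.
have c0 : c ord0 = 0.
  apply: (vertex_add_pspan_ge no_sink _ sum0); apply: lspan_sum => i _.
  by apply/lspanZ/(pspan_ge_nmul (l := 0) rR)/rx.
move: sum0; rewrite c0 scale0r add0r => sum0.
have tail0 := IH (fun i => c (lift ord0 i)).
move=> i; case: (unliftP ord0 i) => [j ->|->//]; apply: tail0.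
have sumE : S *n \sum_(i < n) c (lift ord0 i) *: x (lift ord0 i) = 0.
  by rewrite sum0 nmul0r.
rewrite -[RHS]sumE nmul_sumr; apply: eq_bigr => l _.
by rewrite -nscalerAr /= nmulA SR vx.
Qed.

Lemma path_of_size v n : exists p, path_from v p /\ size p = n.
Proof.
elim: n v => [|n IH] v; first by exists [::].
have [e ev] := out_arrow no_sink v; have [p [ep sp]] := IH (target e).
by exists (e :: p); split; [apply/path_from_cons|rewrite /= sp].
Qed.

(** Without sinks there is a path of every length. If it is unique, the shorter ones are prefixes of
    the longer ones, so two equal targets enclose a closed path. *)
Lemma not_leak v : ~ leak v ->
  (exists p q, [/\ path_from v p, path_from (path_target v p) q, q <> [::]
     & path_target (path_target v p) q = path_target v p]) \/
  (exists p q, [/\ path_from v p, path_from v q, size p = size q & p <> q]).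
Proof.
move=> nleak; apply: contrapT => /not_orP[no_cycle no_branch]; apply: nleak.
have [p pP] := choice (path_of_size v).
have p_unique n q : path_from v q -> size q = n -> p n = q.
  move=> vq szq; apply: contrapT => pq; apply: no_branch.
  by have [vpn szn] := pP n; exists (p n), q; rewrite szq.
have p_inj m n : (m < n)%N -> path_target v (p m) <> path_target v (p n).
  move=> mn tmn; apply: no_cycle; have [vpn szn] := pP n.
  have pm : p m = take m (p n).
    apply: p_unique; last by rewrite size_takel // szn ltnW.
    by move: vpn; rewrite -{1}(cat_take_drop m (p n)) => /path_from_cat[].
  exists (p m), (drop m (p n)); move: vpn tmn.
  rewrite -{1 2}(cat_take_drop m (p n)) -pm path_target_cat.
  move=> /path_from_cat[vpm pmd] tE; split=> //.
  by move/(congr1 size); rewrite size_drop szn => /eqP; rewrite subn_eq0 leqNgt mn.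
exists p; split=> [n|m n /eqP]; first by split=> // q [vq szq]; apply: p_unique.
by rewrite neq_ltn => /orP[/p_inj//|/p_inj H /esym].
Qed.

Lemma independent_corner_all n v : (forall u, ~ leak u) -> independent_corner n v.
Proof.
move=> no_leak; elim: n v => [|n IH] v.
  by exists (fun=> 0); split=> [[]//|c _ []].
have [[p [q [vp pq q0 qE]]]|[p [q [vp vq szpq pq]]]] := not_leak (no_leak v).
  apply: (independent_corner_transfer (vertex_path_elt vp) (ghost_elt_vertex vp)
    (ghost_path_elt vp)).
  exact: independent_corner_cycle pq qE q0.
apply: (independent_corner_branch (vertex_path_elt vp) (ghost_elt_vertex vp)
    (ghost_path_elt vp) (vertex_path_elt vq) (ghost_elt_vertex vq)
    (ghost_path_elt vq) _ (IH _)).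
by apply: ghost_path_elt0 => //; apply: nesym.
Qed.

End NoSink.
End Paths.

(** * Corners of a Leavitt path algebra without sinks and leaks *)

(** Holds vacuously: arrows are nonzero because [e^* e] is a vertex, so [es] would list all arrows
    out of [v], and it is nonempty without sinks; hence [v] would be regular. *)
Lemma gap_vanishing_id (F : fieldType) (G : digraph) :
  (forall v : vertex G, ~ sink v) ->
  (forall v : vertex G, lpa_of F (Vertex v) != 0) ->
  gap_vanishing (id : leavitt F G -> leavitt F G).
Proof.
move=> no_sink v0 v es es_uniq esv v_irr out0; case: v_irr.
exists es; split=> //.
  move=> e; split=> [/esv//|ev]; apply: contrapT => /negP ees.
  have /eqP := v0 (target e); apply.
  by have := nmulA'A F e e; rewrite (out0 e) // nmul0r eqxx.
move=> es0; have [e ev] := out_arrow no_sink v.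
have /eqP := v0 (target e); apply.
by have := nmulA'A F e e; rewrite (out0 e) // ?es0 // nmul0r eqxx.
Qed.

Section NoFiniteCorner.
Variables (F : fieldType) (G : digraph).
Local Notation L := (leavitt F G).
Local Notation V v := (lpa_of F (@Vertex G v)).
Implicit Types (u v w : vertex G) (x y z : L).
Hypothesis no_sink : forall v, ~ sink v.

Let gap_id := gap_vanishing_id no_sink (vertex_neq0 F no_sink).

(** Directness of the grading: reducing a nontrivial relation would give a vertex plus longer paths
    equal to zero. *)
Lemma homog_sum_eq0 (ns : seq nat) (d : int) (x : nat -> L) : uniq ns ->
  {in ns, forall i, lpa_homog (d + i%:Z) (x i)} ->
  \sum_(i <- ns) x i = 0 -> {in ns, forall i, x i = 0}.
Proof.
move=> ns_uniq hx sum0 i0 i0ns; apply: contrapT => /eqP nz.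
have [a [b [w [m [mns w0 abw ab0 abP]]]]] :=
  family_reduce (algebra_hom_id L) gap_id hx i0ns nz.
have : a *n (\sum_(i <- ns) x i) *n b = 0 by rewrite sum0 nmul0r nmul0l.
rewrite nmul_sumr nmul_suml (sum_above ns_uniq mns) // abw -[V w]scale1r.
move/(vertex_add_pspan_ge no_sink) => one0.
have /eqP := oner_neq0 F; apply; apply: one0.
apply: lspan_sum => i; rewrite mem_filter => /andP[mi /abP H].
by apply: pspan_geW (H mi).1; rewrite subn_gt0.
Qed.

Lemma homog_add_eq0 (d : int) x y : lpa_homog d x -> homog_ge (d + 1) y ->
  x + y = 0 -> x = 0.
Proof.
move=> hx /homog_ge_sum [K [t [ht _ ->]]] xt0.
pose s i := if i is j.+1 then t j else x.
have := @homog_sum_eq0 (iota 0 K.+1) d s (iota_uniq _ _).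
move=> /(_ _ _ 0%N); apply=> // [[|i] _|].
- by rewrite addr0.
- by apply: lpa_homog_cast (ht i); rewrite -addrA -intS.
- by rewrite /= big_cons -[1%N]addn0 iotaDl big_map.
Qed.

(** The product expands to [u] plus terms above its lowest degree, so the components of [u] vanish
    one by one from below. *)
Lemma unipotent_sandwich w y (u : L) :
  pspan_ge 1 y -> V w *n u = u -> u *n V w = u ->
  (V w + y) *n u *n (V w + y) = 0 -> u = 0.
Proof.
move=> ry wu uw; have hy : homog_ge 1 y := pspan_ge_homog_ge ry.
have -> : (V w + y) *n u *n (V w + y) = u + (y *n u + (u + y *n u) *n y).
  by rewrite nmulDl wu nmulDr nmulDl uw -(nmulA y) uw addrA.
move=> zuz; have [d [K [t [ht uE]]]] := leavitt_sum u.
elim: K d t ht uE => [|K IH] d t ht uE; first by rewrite uE big_nil.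
have {}uE : u = t 0%N + \sum_(i <- iota 0 K) t i.+1.
  by rewrite uE /= big_cons -[1%N]addn0 iotaDl big_map.
have ht' i : lpa_homog (d + 1 + i%:Z) (t i.+1).
  by apply: lpa_homog_cast (ht i.+1); rewrite -addrA -intS.
have h0 : lpa_homog d (t 0%N) by apply: lpa_homog_cast (ht 0%N); rewrite addr0.
have hu' : homog_ge (d + 1) (\sum_(i <- iota 0 K) t i.+1).
  by apply: lspan_sum => i _; apply: homog_geW (ht' i); rewrite lerDl.
have hu : homog_ge d u.
  rewrite uE; apply: lspanD; first exact: homog_geW h0.
  by apply: homog_ge_leq hu'; rewrite lerDl.
have hyu : homog_ge (d + 1) (y *n u) by rewrite addrC; apply: homog_ge_nmul.
have t0 : t 0%N = 0.
  apply: (homog_add_eq0 h0 (y := \sum_(i <- iota 0 K) t i.+1 +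
    (y *n u + (u + y *n u) *n y))); last by rewrite addrA -uE.
  apply: lspanD => //; apply: lspanD => //; apply: homog_ge_nmul => //.
  by apply: lspanD => //; apply: homog_ge_leq hyu; rewrite lerDl.
by apply: (IH (d + 1) (fun i => t i.+1)) => //; rewrite uE t0 add0r.
Qed.

Hypothesis no_leak : forall v, ~ leak v.

Lemma no_finite_corner x : x != 0 -> ~ exists bs : seq L,
  forall y, lspan (fun b => b \in bs) (x *n y *n x).
Proof.
move=> x0 [bs bsP]; have [d [K [t [ht xE]]]] := leavitt_sum x.
have [i0 i0K ti0] : exists2 i, i \in iota 0 K & t i != 0.
  by apply: (phi_sum_neq0 (algebra_hom_id L)); rewrite -xE.
have [a [b [w [m [mK w0 abw ab0 abP]]]]] :=
  family_reduce (algebra_hom_id L) gap_id (fun i _ => ht i) i0K ti0.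
have abx : a *n x *n b = V w +
    \sum_(i <- [seq i <- iota 0 K | (m < i)%N]) a *n t i *n b.
  by rewrite xE nmul_sumr nmul_suml (sum_above (iota_uniq _ _) mK) // abw.
move: abx; set y := \sum_(i <- [seq _ <- _ | _]) _ => abx.
have ry : pspan_ge 1 y.
  apply: lspan_sum => i; rewrite mem_filter => /andP[mi /abP H].
  by apply: pspan_geW (H mi).1; rewrite subn_gt0.
(* One element more than [size bs], so that their images in the corner at [x] must be dependent. *)
have [t' [wt t_free]] := independent_corner_all F no_sink (size bs).+1 w no_leak.
have [c [[i ci] sum0]] := lspan_dependent (ltnSn _)
  (fun i => bsP (b *n t' i *n a)).
move/eqP: ci; apply; apply: t_free; apply: (unipotent_sandwich (w := w) ry).
- rewrite nmul_sumr; apply: eq_bigr => j _.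
  by rewrite -nscalerAr -(wt j) !nmulA vertex_idem.
- rewrite nmul_suml; apply: eq_bigr => j _.
  by rewrite -nscalerAl -(wt j) -!nmulA vertex_idem.
- rewrite -abx; transitivity
    (a *n (\sum_i c i *: (x *n (b *n t' i *n a) *n x)) *n b).
    rewrite !nmul_sumr !nmul_suml; apply: eq_bigr => j _.
    by rewrite -!nscalerAr -!nscalerAl !nmulA.
  by rewrite sum0 nmul0r nmul0l.
Qed.

End NoFiniteCorner.

(** * Epimorphisms onto algebras without sinks and leaks *)

Section Corollary.
Variables (F : fieldType) (G G' : digraph) (phi : leavitt F G -> leavitt F G').
Hypotheses (phi_epi : algebra_epi phi)
  (no_sink_leak : forall v : vertex G', ~ sink v /\ ~ leak v).
Local Notation V v := (lpa_of F (@Vertex G v)).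
Local Notation A e := (lpa_of F (@Arrow G e)).
Local Notation A' e := (lpa_of F (@Ghost G e)).

Let phi_hom := phi_epi.1.
Let phi0 := algebra_hom0 phi_hom.
Let phiD := algebra_homD phi_hom.
Let phiB := algebra_homB phi_hom.
Let phiZ := algebra_homZ phi_hom.
Let phiM := algebra_homM phi_hom.

Lemma image_no_finite_corner g : phi g != 0 -> ~ exists bs : seq (leavitt F G'),
  forall x, lspan (fun b => b \in bs) (phi (g *n x *n g)).
Proof.
move=> g0 [bs bsP]; apply: (no_finite_corner (fun v => (no_sink_leak v).1)
  (fun v => (no_sink_leak v).2) g0); exists bs => y.
by have [x <-] := phi_epi.2 y; rewrite -!phiM.
Qed.

(** Arrows are killed by [g] or by [phi], so modulo the kernel [g] annihilates all arrows on its
    right and all ghosts on its left. Of the monomials between two copies of [g] only [v] survives,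
    and the corner is spanned by [phi g]. *)
Lemma epi_gap_vanishing : gap_vanishing phi.
Proof.
move=> v es es_uniq esv _ out0; apply: contrapT => /eqP g0.
set g := gap F v es in g0 *.
have gA e : phi (g *n A e) = 0.
  have [/andP[/eqP ev ees]|] := boolP ((source e == v) && (e \notin es)).
    by rewrite gap_nmul_arrow ?out0.
  rewrite negb_and negbK => H; rewrite gap_nmul_arrow0 // => ev.
  by rewrite ev eqxx in H.
have A'g e : phi (A' e *n g) = 0.
  have [/andP[/eqP ev ees]|] := boolP ((source e == v) && (e \notin es)).
    (* A ghost arrow dies together with its arrow. *)
    have <- : A' e *n A e *n A' e = A' e by rewrite nmulA'A eqxx nmulVA' eqxx.
    by rewrite !phiM (out0 e) // nmul0r !nmul0l.
  rewrite negb_and negbK => H; rewrite ghost_nmul_gap // => ev.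
  by rewrite ev eqxx in H.
have gg : phi (g *n V v *n g) = phi g.
  rewrite -nmulA vertex_nmul_gap // {2}/g /gap nmulBr phiB nmul_sumr.
  rewrite (algebra_hom_sum phi_hom) big1 ?subr0 => [|e _].
    by rewrite gap_nmul_vertex.
  by rewrite nmulA phiM gA nmul0l.
apply: (image_no_finite_corner g0); exists [:: phi g] => x.
have [d [K [t [ht ->]]]] := leavitt_sum x.
rewrite nmul_sumr nmul_suml (algebra_hom_sum phi_hom); apply: lspan_sum => i _.
have [k] := homog_mspan (ht i); move: (t i) => y.
have scale (a : F) z : phi (g *n (a *: z) *n g) = a *: phi (g *n z *n g).
  by rewrite -nscalerAr -nscalerAl phiZ.
have add z1 z2 :
    phi (g *n (z1 + z2) *n g) = phi (g *n z1 *n g) + phi (g *n z2 *n g).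
  by rewrite (nmulDr g) (nmulDl (g *n z1)) phiD.
elim=> {k y} [j n k y _|m n k y e _ _ _|n k|n k y z _ ? _ ?|n k a y _ ?].
- elim=> {j y} [u|j e y _ _|j|j y z _ ? _ ?|j a y _ ?].
  + have [->|uv] := eqVneq u v.
      by rewrite gg; apply: lspan_gen; rewrite mem_head.
    have vg : V v *n g = g by apply: vertex_nmul_gap.
    rewrite -nmulA -[g in V u *n g]vg (nmulA (V u)) nmulVV (negPf uv).
    by rewrite nmul0l nmul0r phi0; apply: lspan0.
  + by rewrite nmulA !phiM -phiM gA !nmul0l; apply: lspan0.
  + by rewrite nmul0r nmul0l phi0; apply: lspan0.
  + by rewrite add; apply: lspanD.
  + by rewrite scale; apply: lspanZ.
- by rewrite nmulA -nmulA phiM A'g nmul0r; apply: lspan0.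
- by rewrite nmul0r nmul0l phi0; apply: lspan0.
- by rewrite add; apply: lspanD.
- by rewrite scale; apply: lspanZ.
Qed.

Lemma epi_ker_graded : graded_ideal (ker phi).
Proof.
apply: (ker_graded phi_hom epi_gap_vanishing) => w; exact: image_no_finite_corner.
Qed.

Lemma epi_bijective : (forall v, phi (V v) <> 0) -> bijective phi.
Proof.
move=> phiV.
have no_sink (v : vertex G) : ~ sink v.
  move=> v_sink; apply: (phiV v).
  have out e : source e <> v.
    by move=> ev; have : out_arrows v e := ev; rewrite v_sink.
  (* With no arrows to subtract, the gap projection is the vertex itself. *)
  have := @epi_gap_vanishing v [::]; rewrite /gap big_nil subr0; apply=> //.
  - move=> [[|e fs] [_ fsP fs0]]; first exact: fs0.
    by apply: (out e); apply/fsP/mem_head.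
  - by move=> f /out.
have V0 v : V v != 0 by apply/eqP => v0; apply: (phiV v); rewrite v0 phi0.
have phi_inj x : phi x = 0 -> x = 0.
  move=> x0; have [d [K [t [ht xE]]]] := leavitt_sum x.
  have t0 := sum_ker phi_hom epi_gap_vanishing (fun w => @image_no_finite_corner _)
    (iota_uniq 0 K) (fun i _ => ht i) (etrans (congr1 phi (esym xE)) x0).
  rewrite xE big1_seq // => i /= iK; apply: contrapT => /eqP ti.
  (* A one-element family reduces to a vertex with no higher terms, and this vertex would lie in the
     kernel. *)
  have hti : {in [:: i], forall j, lpa_homog (d + j%:Z) (t j)} by [].
  have [a [b [w [m []]]]] := family_reduce (algebra_hom_id _)
    (gap_vanishing_id no_sink V0) hti (mem_head i [::]) ti.
  rewrite inE => /eqP -> _ atb _ _; apply: (phiV w).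
  by rewrite -atb !phiM t0 // nmul0r nmul0l.
have [psi psiP] := choice phi_epi.2; exists psi => // x.
by apply/eqP; rewrite -subr_eq0; apply/eqP/phi_inj; rewrite phiB psiP subrr.
Qed.

End Corollary.

Theorem corollary35 (F : fieldType) (G G' : digraph)
    (phi : leavitt F G -> leavitt F G') (phi_epi : algebra_epi phi) :
  ((forall v : vertex G', ~ sink v /\ ~ leak v) ->
     graded_ideal (ker phi)) /\
  (row_finite G ->
   (forall v : vertex G', ~ sink v /\ ~ leak v) ->
   (forall v : vertex G, phi (lpa_of F (Vertex v)) <> 0%R) ->
     algebra_iso phi).
Proof.
split=> [no_sink_leak|_ no_sink_leak phiV]; first exact: epi_ker_graded.
by split; [exact: phi_epi.1|exact: epi_bijective].
Qed.
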